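(* Let $d>1$ and let $\mathcal F_m(M)$ be a one-parameter exponential family with mean parameters in $(0,M]$, whose log-partition function $b$ is twice differentiable with continuous second derivative $b''>0$ on $\Theta$, and whose variance function $V$ satisfies, for some $C_L>0$, $|V(\mu)-V(\mu')|\le C_L|\mu-\mu'|$ for all $\mu,\mu'\in(0,M]$. Then there is a constant $C>0$, depending only on $d$ and the family (through $M$, $C_L$ and $V$), such that for every $K\ge2$, every $T\ge2$, and every $K$-armed bandit problem whose reward distributions all belong to the (known) family $\mathcal F_m(M)$, the algorithm General-Exp-KL-MS with $L(k)=k/d$ satisfies $$\mathrm{Reg}(T)\le C\sum_{a\in[K]:\Delta_a>0}\Big(\frac{\ln T}{\Delta_a}+\Delta_a\Big),\qquad \Delta_a=\mu_{\max}-\mu_a.$$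
   Context: Exponential family: given a base measure $m$ on $\mathbb R$, $\{p_\theta(dx)=m(dx)\exp(x\theta-b(\theta)):\theta\in\Theta\}$, where $\Theta\subset\mathbb R$ is an interval and $b(\theta)=\ln\int_{\mathbb R}e^{x\theta}m(dx)$. Members are determined by their mean $b'(\theta)$. The variance function $V(\mu)$ is the variance of the member with mean $\mu$. $\mathrm{KL}(\mu,\mu')$ denotes the Kullback–Leibler divergence $\mathbb E_{X\sim\nu}[\ln\frac{d\nu}{d\nu'}(X)]$ between the members $\nu,\nu'$ with means $\mu,\mu'$. Bandit: each arm $a\in[K]=\{1,\dots,K\}$ has reward distribution $\nu_a$ in the family with mean $\mu_a$; $\mu_{\max}=\max_a\mu_a$. In round $t=1,\dots,T$ the agent picks $I_t\in[K]$ (based on the past and internal randomness) and receives $r_t\sim\nu_{I_t}$, independent of the past given $I_t$. $N_{t,a}=\sum_{i\le t}\mathbf 1\{I_i=a\}$, $\hat\mu_{t,a}=\frac1{N_{t,a}}\sum_{i\le t}r_i\mathbf 1\{I_i=a\}$, $\hat\mu_{t,\max}=\max_a\hat\mu_{t,a}$. It is assumed that empirical means are means of members of the exponential family. Regret: $\mathrm{Reg}(T)=\mathbb E\big[\sum_{t=1}^T(\mu_{\max}-\mu_{I_t})\big]$. General-Exp-KL-MS with inverse temperature function $L$: in rounds $t\le K$ pull $I_t=t$; in each round $t>K$ pull $I_t=a$ with probability $p_{t,a}=\exp\!\big(-L(N_{t-1,a})\,\mathrm{KL}(\hat\mu_{t-1,a},\hat\mu_{t-1,\max})\big)/M_t$,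 where $M_t$ normalizes the probabilities to sum to $1$. *)

(* Defs.v *)
(* MathComp-Analysis; the reals are an arbitrary [R : realType]. *)
From HB Require Import structures.
#[export] Set Warnings "-notation-overridden,-notation-incompatible-prefix".
From mathcomp Require Export all_boot all_order all_algebra.
From mathcomp Require Export all_classical all_reals all_analysis.

Set Implicit Arguments.
Unset Strict Implicit.
Unset Printing Implicit Defensive.

Import Order.TTheory GRing.Theory Num.Theory.
Import numFieldNormedType.Exports.

Local Open Scope classical_set_scope.
Local Open Scope ring_scope.
Local Open Scope charge_scope.

Notation real_law R := (probability (measurableTypeR R) R).

Definition law_mean {R : realType} (nu : real_law R) : R :=
  fine 'E_nu[fun x : measurableTypeR R => (x : R)].

(* The Radon-Nikodym derivative is only meaningful for [nu `<< nu'], which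
   holds for any two members of an exponential family. *)
Definition KLdiv {R : realType} (nu nu' : real_law R) : \bar R :=
  'E_nu[fun x => ln (fine (('d (charge_of_finite_measure nu) '/d nu') x))].

Definition laplace {R : realType}
    (m : {measure set (measurableTypeR R) -> \bar R}) (theta : R) : \bar R :=
  (\int[m]_x (expR (x * theta))%:E)%E.

Definition log_partition {R : realType}
    (m : {measure set (measurableTypeR R) -> \bar R}) (theta : R) : R :=
  ln (fine (laplace m theta)).

Definition expfam {R : realType}
    (m : {measure set (measurableTypeR R) -> \bar R}) (Theta : set R) :
    set (real_law R) :=
  [set nu | exists2 theta, Theta theta &
    forall A, measurable A ->
      nu A = (\int[m]_(x in A) (expR (x * theta - log_partition m theta))%:E)%E].

(* Derivative of [f] at [x] relative to [D]: two-sided at interior points of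
   an interval [D], one-sided at the endpoints that belong to [D]. *)
Definition is_derive_in {R : realType} (D : set R) (f : R -> R) (x l : R) :=
  (f y - f x) / (y - x) @[y --> within D (dnbhs x)] --> l.

Definition C2_posdef_on {R : realType} (D : set R) (f : R -> R) :=
  exists f1 f2 : R -> R,
    [/\ forall x, D x -> is_derive_in D f x (f1 x),
        forall x, D x -> is_derive_in D f1 x (f2 x),
        {within D, continuous f2} &
        forall x, D x -> 0 < f2 x].

Record is_regular_expfam {R : realType}
    (m : {measure set (measurableTypeR R) -> \bar R}) (Theta : set R) : Prop := {
  param_interval : is_interval Theta ;
  laplace_finite : forall theta, Theta theta -> (0 < laplace m theta < +oo)%E ;
  log_partition_C2 : C2_posdef_on Theta (log_partition m) }.

Definition is_variance_function {R : realType} (F : set (real_law R))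
    (V : R -> R) :=
  forall nu, F nu ->
    'V_nu[fun x : measurableTypeR R => (x : R)] = (V (law_mean nu))%:E.

(* The divergence between the members of [F] with means [mu] and [mu'];
   arbitrary if there is no such pair of members. *)
Definition KLmean {R : realType} (F : set (real_law R)) (mu mu' : R) : R :=
  get [set k : R | exists nu nu' : real_law R,
    [/\ F nu /\ law_mean nu = mu, F nu' /\ law_mean nu' = mu' &
        KLdiv nu nu' = k%:E]].

(* Rounds are numbered from 1: [I t] and [r t] are the arm pulled and the
   reward received in round [t >= 1]. The arms [1, ..., K] are the elements
   [0, ..., K - 1] of ['I_K]. *)

Definition pulls {T : Type} {K : nat} (I : nat -> T -> 'I_K)
    (t : nat) (a : 'I_K) (w : T) : nat :=
  (\sum_(1 <= i < t.+1) (I i w == a))%N.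

Definition emp_mean {R : realType} {T : Type} {K : nat} (I : nat -> T -> 'I_K)
    (r : nat -> T -> R) (t : nat) (a : 'I_K) (w : T) : R :=
  (\sum_(1 <= i < t.+1 | I i w == a) r i w) / (pulls I t a w)%:R.

Definition max_over {R : realType} {K : nat} (f : 'I_K -> R) : R :=
  sup (range f).

Definition expklms_weight {R : realType} (F : set (real_law R)) (L : nat -> R)
    {T : Type} {K : nat} (I : nat -> T -> 'I_K) (r : nat -> T -> R)
    (t : nat) (a : 'I_K) (w : T) : R :=
  expR (- (L (pulls I t.-1 a w) *
           KLmean F (emp_mean I r t.-1 a w)
                    (max_over (fun b => emp_mean I r t.-1 b w)))).

Definition expklms_prob {R : realType} (F : set (real_law R)) (L : nat -> R)
    {T : Type} {K : nat} (I : nat -> T -> 'I_K) (r : nat -> T -> R)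
    (t : nat) (a : 'I_K) (w : T) : R :=
  if (t <= K)%N then (a.+1 == t)%:R
  else expklms_weight F L I r t a w / \sum_(b < K) expklms_weight F L I r t b w.

(* The sigma-algebra generated by the arms and rewards of rounds [1 <= i < t]. *)
Definition past {R : realType} {T : Type} {K : nat} (I : nat -> T -> 'I_K)
    (r : nat -> T -> R) (t : nat) : set (set T) :=
  <<s [set A | exists2 i, (1 <= i < t)%N &
         (exists a, A = I i @^-1` [set a]) \/
         (exists2 B : set (measurableTypeR R), measurable B & A = r i @^-1` B)] >>.

(* [I], [r] is a run over rounds [1, ..., T] of the algorithm with inverse
   temperature [L], against arms with reward laws [nu]. The last two fields
   say that, given the past, arm [a] is pulled with probability
   [expklms_prob], and that, given the past and [I t = a], the reward has law
   [nu a]. *)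
Record is_expklms_run {R : realType} (F : set (real_law R)) (L : nat -> R)
    {K : nat} (nu : 'I_K -> real_law R) (T : nat)
    {disp : measure_display} {Omega : measurableType disp}
    (P : probability Omega R)
    (I : nat -> Omega -> 'I_K) (r : nat -> Omega -> R) : Prop := {
  arm_measurable : forall t a, (1 <= t <= T)%N ->
    measurable (I t @^-1` [set a]) ;
  reward_measurable : forall t, (1 <= t <= T)%N ->
    measurable_fun setT (r t) ;
  arm_law : forall t a H, (1 <= t <= T)%N -> past I r t H ->
    P (H `&` I t @^-1` [set a]) =
    (\int[P]_(w in H) (expklms_prob F L I r t a w)%:E)%E ;
  reward_law : forall t a H (B : set (measurableTypeR R)),
    (1 <= t <= T)%N -> past I r t H -> measurable B ->
    P (H `&` I t @^-1` [set a] `&` r t @^-1` B) =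
    (P (H `&` I t @^-1` [set a]) * nu a B)%E }.

Definition emp_means_in_family {R : realType} (F : set (real_law R))
    {K : nat} (T : nat) {disp : measure_display} {Omega : measurableType disp}
    (P : probability Omega R)
    (I : nat -> Omega -> 'I_K) (r : nat -> Omega -> R) :=
  \forall w \ae P, forall t a, (1 <= t <= T)%N -> (0 < pulls I t a w)%N ->
    (law_mean @` F) (emp_mean I r t a w).

Definition gap {R : realType} {K : nat} (nu : 'I_K -> real_law R) (a : 'I_K) : R :=
  max_over (fun b => law_mean (nu b)) - law_mean (nu a).

Definition regret {R : realType} {K : nat} (nu : 'I_K -> real_law R) (T : nat)
    {disp : measure_display} {Omega : measurableType disp}
    (P : probability Omega R) (I : nat -> Omega -> 'I_K) : \bar R :=
  'E_P[fun w => \sum_(1 <= t < T.+1) gap nu (I t w)].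

(* Main.v *)
From HB Require Import structures.
Require Import Defs.
From mathcomp Require Import simple_functions measurable_realfun ring lra zify.

Set Implicit Arguments.
Unset Strict Implicit.
Unset Printing Implicit Defensive.

Import Order.TTheory GRing.Theory Num.Theory.
Import numFieldNormedType.Exports.

Local Open Scope classical_set_scope.
Local Open Scope ring_scope.
Local Open Scope charge_scope.

(* The first reward is an empirical mean, hence the mean of a member, so all
   laws live on ]0, M]: there the log-partition function [b] is finite
   everywhere and the mean is Lipschitz in the natural parameter. As the
   divergence is the Bregman divergence of [b], it dominates a multiple of the
   squared difference of the means.

   Fix a suboptimal arm [a], the best arm [o], and cut the gap into thirds at
   the means of [x] < [y]. After O(ln T / gap^2) pulls of [a], pulling it again
   while its empirical mean is below that of [x] and the largest one is above
   that of [y] has probability at most 1/T. Pulls of [a] while its empirical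
   mean exceeds that of [x] are rare by a Chernoff bound. If all empirical
   means are below that of [y], the sampling probability of [a] is at most
   exp(N_o KL / d) times that of [o]; since d > 1 the exponential is integrable
   against the Chernoff tail of the empirical mean of [o], which is cut into
   levels where KL grows geometrically.

   All Chernoff sums over rounds are bounded without reference to the i.i.d.
   rewards of an arm: E[exp(lambda S - c N)] telescopes along the rounds. *)

(** * Bregman divergences of smooth convex functions *)

(** Two obstacles shape the argument. The sampling probabilities go through [KLmean], a choice
    operator, so [arm_law] is exploited only by comparing lower integrals of pointwise bounds; a
    random comparison factor exp(c N) is first made constant by slicing on the count N. Moreover,
    the divergence of a low empirical mean of the best arm admits no a priori bound, so a single
    comparison rate does not suffice. With levels of ratio (1 + d) / 2, strictly between 1 and d,
    the Chernoff exponent at level j is eta ratio^j, where eta is the divergence from y to the best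
    arm. The comparison costs less than eta ratio^(j+1) / d, and what remains still grows
    geometrically: the inverse rates sum to O(1 / eta). Natural parameters are used instead of means
    because exponential tilts are translations there, and because the auxiliary point in the
    quadratic lower bound may leave [Theta]; bounded support keeps everything finite there. [Theta]
    itself matters for strict monotonicity, by which a mean identifies its parameter. *)

HB.lock Definition bregman {R : realType} (b mu : R -> R) (x y : R) : R :=
  (x - y) * mu x - b x + b y.
Canonical bregman_unlockable := Unlockable bregman.unlock.

Section bregman.
Context {R : realType}.
Variables (b mu : R -> R) (M L : R).
Hypothesis tangent : forall x y, b x + mu x * (y - x) <= b y.
Hypothesis mu_bounds : forall x, 0 <= mu x <= M.
Hypothesis L_gt0 : 0 < L.
Hypothesis mu_lip : forall x y, x <= y -> mu y - mu x <= L * (y - x).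

Local Notation bregman := (bregman b mu).

Lemma bregmanE x y : bregman x y = (x - y) * mu x - b x + b y.
Proof. by rewrite unlock. Qed.

(** This is the excess of [b y] over the tangent at [x]. The point of tangency is the first
    argument, which is the order of KL from the law at [x] to the law at [y]. *)
Lemma bregman_ge0 x y : 0 <= bregman x y.
Proof. by rewrite !bregmanE; have := tangent x y; nra. Qed.

Lemma bregmanxx x : bregman x x = 0.
Proof. by rewrite !bregmanE; ring. Qed.

(** Three-point identity: the cross term is nonnegative when [s] lies between [x] and [y], by
    monotonicity of [mu]. *)
Lemma bregman_split x s y :
  bregman x y = bregman x s + bregman s y + (mu s - mu x) * (y - s).
Proof. by rewrite !bregmanE; ring. Qed.

Lemma mu_nondecreasing x y : x <= y -> mu x <= mu y.
Proof.
rewrite le_eqVlt => /predU1P[->//|xy].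
have := tangent x y; have := tangent y x => h1 h2.
have : 0 <= (mu y - mu x) * (y - x) by nra.
by rewrite pmulr_lge0 ?subr_gt0// subr_ge0.
Qed.

Lemma bregman_split_le x s y : x <= s <= y ->
  bregman x s + bregman s y <= bregman x y.
Proof.
move=> /andP[xs sy]; rewrite (bregman_split x s y) lerDl.
by rewrite mulr_ge0// subr_ge0// mu_nondecreasing.
Qed.

Lemma bregman_split_ge x s y : y <= s <= x ->
  bregman x s + bregman s y <= bregman x y.
Proof.
move=> /andP[ys sx]; rewrite (bregman_split x s y) lerDl.
by rewrite mulr_le0// subr_le0// mu_nondecreasing.
Qed.

Lemma bregman_nested x s s' y : x <= s -> s <= s' -> s' <= y ->
  bregman s s' <= bregman x y.
Proof.
move=> xs ss' s'y.
have h1 : bregman x s + bregman s y <= bregman x y.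
  by apply: bregman_split_le; rewrite xs (le_trans ss').
have h2 : bregman s s' + bregman s' y <= bregman s y.
  by apply: bregman_split_le; rewrite ss'.
by have := bregman_ge0 x s; have := bregman_ge0 s' y; lra.
Qed.

(** Chernoff bound in pointwise form. For [n] rewards of mean [z], the log-likelihood ratio of
    parameter [x] against [t] is at least [n * bregman x t] once [z] lies beyond [mu x] as seen from
    [t]. *)
Lemma bregman_tilt (x t n z : R) : 0 <= n -> 0 <= (x - t) * (z - mu x) ->
  0 <= (x - t) * (n * z) - (b x - b t + bregman x t) * n.
Proof.
move=> n0 h; have -> : (x - t) * (n * z) - (b x - b t + bregman x t) * n =
  n * ((x - t) * (z - mu x)) by rewrite bregmanE; ring.
exact: mulr_ge0.
Qed.

(** Part [c] of the exponent is held back, so the tilted process dominates exp(c n) and can pay for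
    a comparison factor. *)
Lemma bregman_tilt_slack (x t n z c e : R) : 0 <= n -> 0 <= (x - t) * (z - mu x) ->
  e <= bregman x t ->
  c * n <= (x - t) * (n * z) - (b x - b t + (e - c)) * n.
Proof.
move=> n0 h; rewrite bregmanE => eb; rewrite -subr_ge0.
have -> : (x - t) * (n * z) - (b x - b t + (e - c)) * n - c * n =
  n * ((x - t) * (z - mu x) + ((x - t) * mu x - b x + b t - e)) by ring.
by rewrite mulr_ge0// addr_ge0// subr_ge0.
Qed.

(* Three-point identity at the point where the slope is halfway between
   [mu y] and [mu x]; it need not lie between [x] and [y]. *)
Lemma bregman_quadratic x y : (mu x - mu y) ^+ 2 <= 4 * L * bregman x y.
Proof.
(* [e] is the sign and [D] the size of the slope difference. Moving by [D / (2 * L)] from [y]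
   towards [x] changes the slope by at most [D / 2], so the cross term of [bregman_split] is at
   least [D ^+ 2 / (4 * L)]. *)
have main D e s : (mu x - mu y = e * D) -> e ^+ 2 = 1 -> 0 <= D ->
    s = y + e * (D / (2 * L)) -> D / 2 <= e * (mu x - mu s) ->
    (mu x - mu y) ^+ 2 <= 4 * L * bregman x y.
  move=> -> e2 D0 sE eD; rewrite (bregman_split x s y) exprMn e2 mul1r.
  have -> : y - s = - (e * (D / (2 * L))) by rewrite sE; ring.
  have -> : (mu s - mu x) * - (e * (D / (2 * L))) =
    (e * (mu x - mu s)) * (D / (2 * L)) by ring.
  apply: (@le_trans _ _ (4 * L * (D / 2 * (D / (2 * L))))).
    by rewrite le_eqVlt; apply/orP; left; apply/eqP; field; rewrite gt_eqF.
  apply: ler_wpM2l; first by rewrite mulr_ge0// ltW.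
  have : D / 2 * (D / (2 * L)) <= e * (mu x - mu s) * (D / (2 * L)).
    by rewrite ler_wpM2r// divr_ge0// mulr_ge0// ltW.
  by have := bregman_ge0 x s; have := bregman_ge0 s y; lra.
have [yx|xy] := leP y x.
  have h := mu_nondecreasing yx.
  apply: (main (mu x - mu y) 1 (y + 1 * ((mu x - mu y) / (2 * L)))) => //.
  - by rewrite mul1r.
  - by rewrite expr1n.
  - lra.
  - have := @mu_lip y (y + 1 * ((mu x - mu y) / (2 * L))).
    have -> : L * (y + 1 * ((mu x - mu y) / (2 * L)) - y) = (mu x - mu y) / 2.
      by field; rewrite gt_eqF.
    rewrite lerDl mul1r divr_ge0 ?subr_ge0 ?mulr_ge0 ?(ltW L_gt0)//.
    by move=> /(_ isT); lra.
have h := mu_nondecreasing (ltW xy).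
apply: (main (mu y - mu x) (- 1) (y + - 1 * ((mu y - mu x) / (2 * L)))) => //.
- by ring.
- by ring.
- lra.
- have := @mu_lip (y + - 1 * ((mu y - mu x) / (2 * L))) y.
  have -> : L * (y - (y + - 1 * ((mu y - mu x) / (2 * L)))) = (mu y - mu x) / 2.
    by field; rewrite gt_eqF.
  rewrite mulN1r gerDl oppr_le0 divr_ge0 ?subr_ge0 ?mulr_ge0 ?(ltW L_gt0)//.
  by move=> /(_ isT); lra.
Qed.

Lemma lipschitz_continuous (f : R -> R) (k : R) :
  (forall x y, `|f x - f y| <= k * `|x - y|) -> continuous f.
Proof.
move=> fk x; have k1 : 0 < `|k| + 1 by rewrite ltr_wpDl.
apply/cvgrPdist_lt => e e0; near=> y.
apply: (le_lt_trans (fk x y)).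
apply: (@le_lt_trans _ _ ((`|k| + 1) * `|x - y|)).
  by rewrite ler_wpM2r// (le_trans (ler_norm k))// lerDl.
rewrite mulrC -ltr_pdivlMr//; near: y.
by apply: cvgr_dist_lt => //; rewrite divr_gt0.
Unshelve. all: by end_near. Qed.

Lemma mu_continuous : continuous mu.
Proof.
apply: (@lipschitz_continuous _ L) => x y.
have [xy|/ltW yx] := leP x y.
  by rewrite distrC (distrC x) !ger0_norm ?subr_ge0 ?mu_nondecreasing ?mu_lip.
by rewrite !ger0_norm ?subr_ge0 ?mu_nondecreasing ?mu_lip.
Qed.

Lemma b_continuous : continuous b.
Proof.
apply: (@lipschitz_continuous _ M) => x y.
have hx := mu_bounds x; have hy := mu_bounds y.
have := tangent x y; have := tangent y x => h1 h2.
rewrite ler_norml; have [xy|yx] := leP x y.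
  by rewrite distrC ger0_norm ?subr_ge0//; nra.
by rewrite gtr0_norm ?subr_gt0//; nra.
Qed.

Lemma mu_ivt x y (v : R) : x <= y -> mu x <= v <= mu y ->
  exists2 s, x <= s <= y & mu s = v.
Proof.
move=> xy v_xy; have [||s] := @IVT R mu x y v xy.
- exact/continuous_subspaceT/mu_continuous.
- by rewrite min_l ?max_r// mu_nondecreasing.
- by rewrite in_itv/=; exists s.
Qed.

Lemma bregman_ivt x y (v : R) : x <= y -> 0 <= v <= bregman x y ->
  exists2 s, x <= s <= y & bregman s y = v.
Proof.
move=> xy v_xy; have [||s] := @IVT R (bregman ^~ y) x y v xy.
- apply: continuous_subspaceT => z; rewrite /continuous_at bregmanE; under eq_fun do rewrite bregmanE.
  apply: cvgD; last exact: cvg_cst.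
  apply: cvgB; last exact: b_continuous.
  by apply: cvgM; [apply: cvgB; [exact: cvg_id|exact: cvg_cst]|exact: mu_continuous].
- by rewrite bregmanxx min_r ?max_l// bregman_ge0.
- by rewrite in_itv/=; exists s.
Qed.

End bregman.

(** At an interior point of [D] the relative derivative is a two-sided limit, hence unique. This
    gives access to the values of the functions that [C2_posdef_on] merely asserts to exist. *)
Lemma is_derive_in_affine {R : realType} (D : set R) (f : R -> R) (x y s l c : R) :
  x < s < y -> `]x, y[%classic `<=` D ->
  (forall z, x < z < y -> f z = f s + c * (z - s)) ->
  is_derive_in D f s l -> l = c.
Proof.
move=> xsy xyD faff fl.
have nbhs_xy : nbhs s `]x, y[%classic by apply: near_in_itvoo; rewrite in_itv.
have dD : within D (dnbhs s) `<=` dnbhs s.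
  move=> P; rewrite /within/= => DP; near=> z.
  have /xyD Dz : `]x, y[%classic z by near: z; exact: nbhs_dnbhs.
  by move: Dz; near: z.
have {}fl : (f z - f s) / (z - s) @[z --> dnbhs s] --> l.
  by move=> P /fl; exact: dD.
suff fc : (f z - f s) / (z - s) @[z --> dnbhs s] --> c.
  exact: (@cvg_unique _ (@norm_hausdorff R R) _ _ _ _ fl fc).
apply: cvg_near_cst; near=> z.
have zs : z != s by near: z; exact: nbhs_dnbhs_neq.
have : `]x, y[%classic z by near: z; exact: nbhs_dnbhs.
rewrite /= in_itv/= => /faff ->.
by rewrite addrC addKr mulfK// subr_eq0.
Unshelve. all: by end_near. Qed.

Section strict.
Context {R : realType}.
Variables (b mu : R -> R) (Theta : set R).
Hypothesis tangent : forall x y, b x + mu x * (y - x) <= b y.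
Hypothesis Theta_itv : is_interval Theta.
Hypothesis b_C2 : C2_posdef_on Theta b.

(* Equal slopes at two points would make [b] affine in between. *)
Lemma mu_increasing x y : Theta x -> Theta y -> x < y -> mu x < mu y.
Proof.
move=> Tx Ty xy; rewrite lt_neqAle (mu_nondecreasing tangent) ?ltW// andbT.
apply/eqP => mu_xy; have [b1 [b2 [db1 db2 _ b2_gt0]]] := b_C2.
have xyT : `]x, y[%classic `<=` Theta.
  move=> z; rewrite /= in_itv/= => /andP[xz zy].
  by apply: (Theta_itv Tx Ty); rewrite !ltW.
have mu_cst z : x < z < y -> mu z = mu x.
  move=> /andP[xz zy]; apply/eqP; rewrite eq_le.
  by rewrite {1}mu_xy !(mu_nondecreasing tangent)// ltW.
(* With equal slopes at [z] and [s], the two tangent inequalities combine to an equality. *)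
have b_aff z s : x < z < y -> x < s < y -> b z = b s + mu x * (z - s).
  move=> hz hs; have := tangent z s; have := tangent s z.
  by rewrite !mu_cst//; lra.
have b1_cst s : x < s < y -> b1 s = mu x.
  move=> hs; apply: (is_derive_in_affine hs xyT _ (db1 s _)).
    by move=> z hz; apply: b_aff.
  by apply: xyT; rewrite /= in_itv.
have [s hs] : exists s, x < s < y.
  by exists ((x + y) / 2); rewrite !midf_lt.
have Ts : Theta s by apply: xyT; rewrite /= in_itv.
have := b2_gt0 s Ts; suff -> : b2 s = 0 by rewrite ltxx.
apply: (is_derive_in_affine hs xyT _ (db2 s Ts)) => z hz.
by rewrite !b1_cst// mul0r addr0.
Qed.

End strict.

(** * Densities, independence and lower integrals *)

Section density.
Local Open Scope ereal_scope.
Import HBNNSimple.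
Context {d d' : measure_display} {T : measurableType d} {T' : measurableType d'}
  {R : realType}.
Variables (m : {measure set T -> \bar R}) (nu : {measure set T' -> \bar R}).
Variables (phi : T -> T') (g : T -> R).
Hypothesis mphi : measurable_fun setT phi.
Hypothesis mg : measurable_fun setT g.
Hypothesis g_ge0 : forall x, (0 <= g x)%R.
Hypothesis nuE : forall A, measurable A -> nu A = \int[m]_(x in phi @^-1` A) (g x)%:E.

Let nnsfun_density (h : {nnsfun T' >-> R}) :
  \int[nu]_x (h x)%:E = \int[m]_x ((h (phi x))%:E * (g x)%:E).
Proof.
have mphiE y : measurable (phi @^-1` (h @^-1` [set y])).
  by rewrite -[X in measurable X]setTI; apply: mphi.
rewrite integralT_nnsfun sintegralE.
under [RHS]eq_integral => x _.
  rewrite fimfunE -fsumEFin// ge0_mule_fsuml; last first.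
    by move=> y; exact: nnfun_muleindic_ge0.
  over.
rewrite ge0_integral_fsum//; last 2 first.
- move=> y; apply: emeasurable_funM; last exact/measurable_EFinP.
  apply/measurable_EFinP; apply: measurable_funM => //.
  by apply: (measurableT_comp _ mphi); exact: measurable_indic.
- by move=> y x _; apply: mule_ge0; [exact: nnfun_muleindic_ge0|rewrite lee_fin].
apply: eq_fsbigr => y /set_mem[z _ <-].
rewrite nuE// integral_mkcond -ge0_integralZl ?lee_fin//; last 2 first.
- by apply/measurable_restrict => //; apply: measurable_funTS; exact/measurable_EFinP.
- by move=> x _; apply: erestrict_ge0 => x' _; rewrite lee_fin.
apply: eq_integral => x _; rewrite patchE EFinM -muleA indicE.
rewrite (_ : (phi x \in _) = (x \in phi @^-1` (h @^-1` [set h z]))); last first.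
  by apply/idP/idP => /set_mem ?; exact/mem_set.
by case: ifP => _; rewrite ?mul1e// mul0e.
Qed.

(** Pushforward and density in one statement: [phi := id] changes measure between [m] and a member,
    while a random variable as [phi] gives its law under a weighted probability. *)
Lemma ge0_integral_density (f : T' -> \bar R) : measurable_fun setT f ->
  (forall x, 0 <= f x) -> \int[nu]_x f x = \int[m]_x (f (phi x) * (g x)%:E).
Proof.
move=> mf f_ge0; pose h := nnsfun_approx measurableT mf.
have hf x : (h n x)%:E @[n --> \oo] --> f x by exact: cvg_nnsfun_approx.
have h_nd x : {homo (fun n => h n x) : a b / (a <= b)%N >-> (a <= b)%R}.
  by move=> a b ab; exact/lefP/nd_nnsfun_approx.
transitivity (limn (fun n => \int[nu]_x (h n x)%:E)).
  rewrite -monotone_convergence//.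
  - by apply: eq_integral => x _; apply/esym/cvg_lim.
  - by move=> n; exact/measurable_EFinP.
  - by move=> n x _; rewrite lee_fin.
  - by move=> x _ a b /h_nd; rewrite lee_fin.
transitivity (limn (fun n => \int[m]_x ((h n (phi x))%:E * (g x)%:E))).
  by congr (limn _); apply/funext => n; exact: nnsfun_density.
rewrite -monotone_convergence//.
- apply: eq_integral => x _; apply/cvg_lim => //.
  by apply: cvgeZr => //; exact: hf.
- move=> n; apply: emeasurable_funM; apply/measurable_EFinP => //.
  exact: measurableT_comp.
- by move=> n x _; rewrite mule_ge0 ?lee_fin.
- by move=> x _ a b /h_nd hab; rewrite lee_wpmul2r ?lee_fin.
Qed.

End density.

Section independence.
Local Open Scope ereal_scope.
Context {d : measure_display} {T : measurableType d} {R : realType}.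
Variables (P : probability T R) (D : set T) (Y W : T -> R) (nu : real_law R).
Variable g : measurableTypeR R -> R.
Hypothesis mD : measurable D.
Hypothesis mY : measurable_fun setT (Y : T -> measurableTypeR R).
Hypothesis mW : measurable_fun setT (W : T -> measurableTypeR R).
Hypothesis mg : measurable_fun setT g.
Hypothesis g_ge0 : forall x, (0 <= g x)%R.
Hypothesis Y_ge0 : forall x, (0 <= Y x)%R.
Hypothesis indep : forall A B : set (measurableTypeR R), measurable A -> measurable B ->
  P (Y @^-1` A `&` D `&` W @^-1` B) = P (Y @^-1` A `&` D) * nu B.
Hypothesis g_int1 : \int[nu]_x (g x)%:E = 1.

Let mYA (A : set (measurableTypeR R)) : measurable A -> measurable (Y @^-1` A).
Proof. by move=> mA; rewrite -[X in measurable X]setTI; exact: mY. Qed.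

Let mWB (A : set (measurableTypeR R)) : measurable A -> measurable (W @^-1` A).
Proof. by move=> mA; rewrite -[X in measurable X]setTI; exact: mW. Qed.

Let mgW : measurable_fun setT (g \o W).
Proof. exact: measurableT_comp. Qed.

(** Conditionally on [D] and an event of [Y], the variable [W] has law [nu], so [g \o W] has
    conditional mean 1. *)
Let level_integral (A : set (measurableTypeR R)) : measurable A ->
  P (Y @^-1` A `&` D) = \int[P]_(w in Y @^-1` A `&` D) (g (W w))%:E.
Proof.
move=> mA; set E := _ `&` _; have mE : measurable E by exact: measurableI (mYA mA) mD.
have [PE0|PE0] := eqVneq (P E) 0.
  rewrite PE0 (@ge0_negligible_integral _ _ _ P E E)//.
  - by rewrite setDv integral_set0.
  - by apply: measurable_funTS; exact/measurable_EFinP.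
  - by move=> w _; rewrite lee_fin.
have PEfin : P E \is a fin_num by exact: fin_num_measure.
pose e := fine (P E); have PEe : P E = e%:E by rewrite /e fineK.
have e_gt0 : (0 < e)%R by rewrite -lte_fin -PEe lt0e PE0 measure_ge0.
pose k w : R := (e^-1 * \1_E w)%R.
have mk : measurable_fun setT k.
  by apply: measurable_funM => //; exact: measurable_indic.
have k_ge0 w : (0 <= k w)%R by rewrite /k mulr_ge0// invr_ge0 ltW.
have nuE B : measurable B -> nu B = \int[P]_(w in W @^-1` B) (k w)%:E.
  move=> mB; rewrite /k.
  under eq_integral do rewrite EFinM.
  rewrite ge0_integralZl_EFin; last 4 first.
  - exact: mWB.
  - by move=> w _; rewrite lee_fin.
  - by apply: measurable_funTS; apply/measurable_EFinP; exact: measurable_indic.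
  - by rewrite invr_ge0 ltW.
  rewrite integral_indic//; last exact: mWB.
  have hE : P (E `&` W @^-1` B) = P E * nu B := indep mA mB.
  by rewrite [X in _ * X]hE PEe muleA -EFinM mulVf ?mul1e// gt_eqF.
have := ge0_integral_density mW mk k_ge0 nuE
  (f := fun x => (g x)%:E).
rewrite g_int1 => h; have {}h := h _ _.
rewrite PEe -[LHS]mule1 h; last 2 first.
- exact/measurable_EFinP.
- by move=> x; rewrite lee_fin.
rewrite -ge0_integralZl_EFin//.
- rewrite [RHS]integral_mkcond; apply: eq_integral => w _.
  rewrite patchE /k indicE; case: ifP => _.
    by rewrite mulr1 -!EFinM mulrCA mulfV ?mulr1// gt_eqF.
  by rewrite mulr0 !mule0.
- by move=> w _; rewrite mule_ge0 ?lee_fin.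
- by apply: emeasurable_funM; apply/measurable_EFinP.
- exact: ltW.
Qed.

(** By [level_integral], weighting by [g \o W] does not change the image of [P] restricted to [D]
    under [Y]; both integrals are the mean of that image. *)
Lemma integral_indep : \int[P]_(w in D) (Y w * g (W w))%:E = \int[P]_(w in D) (Y w)%:E.
Proof.
pose rho_of : {measure set (measurableTypeR R) -> \bar R} :=
  pushforward (mrestr P mD) (Y : T -> measurableTypeR R).
pose rho := rho_of mY.
have mI : measurable_fun setT (\1_D : T -> R) by exact: measurable_indic.
have rho1 A : measurable A -> rho A = \int[P]_(w in Y @^-1` A) (\1_D w)%:E.
  move=> mA; rewrite integral_indic; [|exact: mYA|exact: mD].
  exact: (congr1 (fun X => P X) (setIC _ _)).
have rho2 A : measurable A -> rho A = \int[P]_(w in Y @^-1` A) (\1_D w * g (W w))%:E.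
  move=> mA; rewrite (level_integral mA : rho A = _) integral_mkcondr.
  apply: eq_integral => w _; rewrite patchE indicE.
  by case: ifP => _; rewrite ?mul1r// mul0r.
(* The change of variables asks for an integrand that is nonnegative on the whole line; the positive
   part agrees with the identity on the values of [Y]. *)
pose f (y : measurableTypeR R) : \bar R := (Num.max y 0%R)%:E.
have mf : measurable_fun setT f by apply/measurable_EFinP; exact: measurable_maxr.
have f0 y : 0 <= f y by rewrite lee_fin le_max lexx orbT.
have h1 := ge0_integral_density mY mI _ rho1 mf f0.
have h2 := ge0_integral_density mY _ _ rho2 mf f0.
rewrite integral_mkcond [RHS]integral_mkcond.
transitivity (\int[rho]_x f x).
  rewrite h2; last 2 first.
  - by apply: measurable_funM => //; exact: mgW.
  - by move=> w; rewrite mulr_ge0.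
  apply: eq_integral => w _; rewrite patchE indicE /f max_l//.
  by case: ifP => _; rewrite ?mul1r// mul0r mule0.
rewrite h1//; apply: eq_integral => w _; rewrite patchE indicE /f max_l//.
by case: ifP => _; rewrite ?mule1// mule0.
Qed.

End independence.

Section lower_integral.
Local Open Scope ereal_scope.
Import HBNNSimple.
Context {d : measure_display} {T : measurableType d} {R : realType}.
Variable mu : {measure set T -> \bar R}.

(* No measurability is needed: the integral of a nonnegative function is a
   supremum over simple functions. *)
Lemma ge0_le_integralZ (D N0 : set T) (f g : T -> R) (c : R) :
  (0 < c)%R -> measurable N0 -> mu N0 = 0 ->
  (forall x, D x -> (0 <= f x)%R) -> (forall x, D x -> (0 <= g x)%R) ->
  (forall x, D x -> ~ N0 x -> (f x <= c * g x)%R) ->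
  \int[mu]_(x in D) (f x)%:E <= c%:E * \int[mu]_(x in D) (g x)%:E.
Proof.
move=> c0 mN0 N00 f0 g0 fg.
rewrite integral_mkcond [X in _ * X]integral_mkcond.
rewrite !ge0_integralTE; last 2 first.
- by move=> x; apply: erestrict_ge0 => y Dy; rewrite lee_fin g0.
- by move=> x; apply: erestrict_ge0 => y Dy; rewrite lee_fin f0.
apply/ge_ereal_sup => _ [h /= hf <-].
(* A simple function below [f], cut off on [N0] and divided by [c], lies below [g] and so competes
   in the supremum for [g]. *)
pose h1 := proj_nnsfun h (measurableC mN0).
have -> : sintegral mu h = sintegral mu h1.
  rewrite -!integralT_nnsfun (ge0_negligible_integral mN0)//; last 2 first.
  - exact/measurable_EFinP.
  - by move=> x _; rewrite lee_fin.
  rewrite setTD integral_mkcond; apply: eq_integral => x _.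
  rewrite patchE /h1/= /proj_nnsfun/= mindicE.
  by case: (x \in ~` N0); rewrite ?mulr1 ?mulr0.
have c'0 : (0 <= c^-1)%R by rewrite invr_ge0 ltW.
rewrite -lee_pdivrMl// -sintegralrM (_ : (_ \* _)%R = scale_nnsfun h1 c'0)//.
apply: ereal_sup_ubound; exists (scale_nnsfun h1 c'0) => // x /=.
rewrite /h1/= mindicE; case: (boolP (x \in ~` N0)) => [/set_mem Nx|_]; last first.
  by rewrite mulr0 mulr0; apply: erestrict_ge0 => y Dy; rewrite lee_fin g0.
rewrite mulr1; have := hf x; rewrite !patchE; case: ifPn => [/set_mem Dx|_].
  rewrite !lee_fin => hfx; rewrite ler_pdivrMl// (le_trans hfx)//.
  exact: fg.
by rewrite !lee_fin => hx0; rewrite mulr_ge0_le0.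
Qed.

End lower_integral.

(** * Exponential families on a bounded interval *)

(** From [1 - z <= expR (- z)] and [1 <= (1 - z) * (1 + 2 * z)]. *)
Lemma expR_double_ge {R : realType} (z : R) : 0 <= z <= 1 / 2 -> expR z <= 1 + 2 * z.
Proof.
move=> /andP[z0 z1]; have := expR_ge1Dx (- z); have := expRxMexpNx_1 z.
have := expR_gt0 z; nra.
Qed.

Definition ell {R : realType} (m : {measure set (measurableTypeR R) -> \bar R})
    (M theta : R) : R :=
  \int[m]_(x in `]0, M]%classic) expR (x * theta).

Definition ell1 {R : realType} (m : {measure set (measurableTypeR R) -> \bar R})
    (M theta : R) : R :=
  \int[m]_(x in `]0, M]%classic) (x * expR (x * theta)).

(** Classically the derivative of the log-partition function. On a bounded support it makes sense
    for every [theta], inside [Theta] or not. *)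
HB.lock Definition tilted_mean {R : realType}
    (m : {measure set (measurableTypeR R) -> \bar R}) (M theta : R) : R :=
  ell1 m M theta / ell m M theta.
Canonical tilted_mean_unlockable := Unlockable tilted_mean.unlock.

Section bounded_support.
Context {R : realType}.
Variables (m : {measure set (measurableTypeR R) -> \bar R}) (M theta0 : R).
Let D : set (measurableTypeR R) := `]0, M]%classic.
Hypothesis M_gt0 : 0 < M.
Hypothesis m_supp : m (~` D) = 0%E.
Hypothesis laplace_theta0 : (0 < laplace m theta0 < +oo)%E.

Let mD : measurable D. Proof. exact: measurable_itv. Qed.


Local Notation ell := (ell m M).
Local Notation ell1 := (ell1 m M).
Local Notation tilted_mean := (tilted_mean m M).

Let tilted_meanE theta : tilted_mean theta = ell1 theta / ell theta.
Proof. by rewrite unlock. Qed.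

Let measurable_exp (theta : R) (A : set (measurableTypeR R)) :
  measurable_fun A (fun x : measurableTypeR R => expR (x * theta) : R).
Proof. by apply: measurable_funTS; apply: measurableT_comp => //; exact: measurable_funM. Qed.

Lemma laplaceE theta : laplace m theta = (\int[m]_(x in D) (expR (x * theta))%:E)%E.
Proof.
rewrite /laplace (@ge0_negligible_integral _ _ _ m setT (~` D)).
- by rewrite setTD setCK.
- exact: measurableC.
- exact: measurableT.
- apply/measurable_EFinP. exact: measurable_exp.
- by move=> x _; rewrite lee_fin expR_ge0.
- exact: m_supp.
Qed.

(** On a bounded support a change of [theta] costs a constant factor, so finiteness at [theta0]
    spreads to every parameter. *)
Let expR_base theta x : D x ->
  expR (x * theta) <= expR (M * `|theta - theta0|) * expR (x * theta0).
Proof.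
rewrite /D/= in_itv/= => /andP[x0 xM]; rewrite -expRD ler_expR.
have : x * (theta - theta0) <= M * `|theta - theta0|.
  apply: (le_trans (ler_norm _)); rewrite normrM (ger0_norm (ltW x0)).
  by rewrite ler_wpM2r.
lra.
Qed.

Let integrable_base : m.-integrable D (fun x => (expR (x * theta0))%:E).
Proof.
apply/integrableP; split; first by apply/measurable_EFinP; exact: measurable_exp.
under eq_integral do rewrite gee0_abs ?lee_fin ?expR_ge0//.
by rewrite -laplaceE; case/andP: laplace_theta0.
Qed.

Lemma integrable_expR theta : m.-integrable D (EFin \o (fun x => expR (x * theta))).
Proof.
have := integrableZl mD (expR (M * `|theta - theta0|)) integrable_base.
apply: le_integrable => //; first by apply/measurable_EFinP; exact: measurable_exp.
move=> x Dx; rewrite -EFinM !gee0_abs ?lee_fin ?mulr_ge0 ?expR_ge0//.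
exact: expR_base.
Qed.

Lemma integrable_expR1 theta :
  m.-integrable D (EFin \o (fun x => x * expR (x * theta))).
Proof.
have := integrableZl mD M (integrable_expR theta).
apply: le_integrable => //.
  by apply/measurable_EFinP; exact: measurable_funM.
move=> x; rewrite /D/= in_itv/= => /andP[x0 xM].
rewrite /= lee_fin !ger0_norm ?mulr_ge0 ?expR_ge0 ?(ltW x0) ?(ltW M_gt0)//.
by rewrite ler_wpM2r ?expR_ge0.
Qed.

Lemma EFin_ell theta : (ell theta)%:E = laplace m theta.
Proof.
rewrite laplaceE /ell /Rintegral fineK//.
by apply: integrable_fin_num => //; exact: integrable_expR.
Qed.

Lemma ell_gt0 theta : 0 < ell theta.
Proof.
have h0 : 0 < ell theta0 by rewrite -lte_fin EFin_ell; case/andP: laplace_theta0.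
have : ell theta0 <= expR (M * `|theta - theta0|) * ell theta.
  rewrite /ell -RintegralZl//; last exact: integrable_expR.
  apply: le_Rintegral => //.
    exact: (integrableZl mD _ (integrable_expR theta)).
  move=> x; rewrite /D/= in_itv/= => /andP[x0 xM].
  rewrite -expRD ler_expR.
  have : x * (theta0 - theta) <= M * `|theta - theta0|.
    apply: (le_trans (ler_norm _)); rewrite normrM (ger0_norm (ltW x0)) distrC.
    by rewrite ler_wpM2r.
  lra.
by move=> /(lt_le_trans h0); rewrite pmulr_rgt0// expR_gt0.
Qed.

Lemma log_partitionE theta : log_partition m theta = ln (ell theta).
Proof. by rewrite /log_partition -EFin_ell. Qed.

Lemma expR_log_partition theta : expR (log_partition m theta) = ell theta.
Proof. by rewrite log_partitionE lnK// posrE ell_gt0. Qed.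

Lemma tilted_mean_bounds theta : 0 <= tilted_mean theta <= M.
Proof.
rewrite !tilted_meanE divr_ge0 ?(ltW (ell_gt0 _))//=; last first.
  apply: Rintegral_ge0 => x; rewrite /D/= in_itv/= => /andP[x0 _].
  by rewrite mulr_ge0 ?expR_ge0// ltW.
rewrite ler_pdivrMr ?ell_gt0// /ell -RintegralZl//; last exact: integrable_expR.
apply: le_Rintegral => //; first exact: integrable_expR1.
  exact: (integrableZl mD _ (integrable_expR theta)).
move=> x; rewrite /D/= in_itv/= => /andP[x0 xM].
by rewrite ler_wpM2r ?expR_ge0.
Qed.

(* [1 + z <= exp z] at [z = h (x - mean)], integrated against the tilted law. *)
Lemma log_partition_tangent x y :
  log_partition m x + tilted_mean x * (y - x) <= log_partition m y.
Proof.
rewrite -ler_expR expRD !expR_log_partition.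
set h := y - x; set c := tilted_mean x * h.
have key : expR c * (1 - c) * ell x + expR c * h * ell1 x <= ell y.
  rewrite /ell /ell1 -!RintegralZl//; [|exact: integrable_expR1|exact: integrable_expR].
  have i0 := integrableZl mD (expR c * (1 - c)) (integrable_expR x).
  have i1 := integrableZl mD (expR c * h) (integrable_expR1 x).
  rewrite -RintegralD//; apply: le_Rintegral => //.
  - exact: (integrableD mD i0 i1).
  - exact: integrable_expR.
  move=> z _.
  have -> : z * y = c + (z * h - c) + z * x by rewrite /h; ring.
  rewrite expRD expRD.
  have := expR_ge1Dx (z * h - c); have := expR_gt0 c; have := expR_gt0 (z * x).
  move=> h1 h2 h3.
  have : expR c * (1 + (z * h - c)) * expR (z * x) <=
         expR c * expR (z * h - c) * expR (z * x).
    by rewrite ler_wpM2r ?expR_ge0// ler_wpM2l ?expR_ge0.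
  lra.
have e1 : ell1 x = tilted_mean x * ell x by rewrite tilted_meanE divfK ?gt_eqF ?ell_gt0.
move: key; rewrite e1 mulrC.
have -> // : ell x * (expR c * (1 - c)) + expR c * h * (tilted_mean x * ell x) =
  ell x * expR c by rewrite /c; ring.
Qed.

(** If [M * (y - x)] exceeds 1/2, the bound exceeds [M]. Otherwise the normaliser does not decrease
    and the first moment grows by a factor of at most [expR (M * (y - x))], which is at most
    [1 + 2 * M * (y - x)]. *)
Lemma tilted_mean_lip x y : x <= y ->
  tilted_mean y - tilted_mean x <= 2 * M ^+ 2 * (y - x).
Proof.
move=> xy; have /andP[mx0 mxM] := tilted_mean_bounds x.
have /andP[my0 myM] := tilted_mean_bounds y.
have [hM|hM] := leP (M * (y - x)) (1 / 2); last first.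
  have : M <= 2 * M * (M * (y - x)) by nra.
  rewrite expr2; lra.
have lexy : ell x <= ell y.
  apply: le_Rintegral => //; [exact: integrable_expR..|].
  move=> z; rewrite /D/= in_itv/= => /andP[z0 zM].
  by rewrite ler_expR ler_wpM2l// ltW.
have le1 : ell1 y <= expR (M * (y - x)) * ell1 x.
  rewrite /ell1 -RintegralZl//; last exact: integrable_expR1.
  apply: le_Rintegral => //; first exact: integrable_expR1.
    exact: (integrableZl mD _ (integrable_expR1 x)).
  move=> z; rewrite /D/= in_itv/= => /andP[z0 zM].
  rewrite mulrCA; apply: ler_wpM2l; first exact: ltW.
  rewrite -expRD ler_expR.
  have : 0 <= (M - z) * (y - x) by rewrite mulr_ge0 ?subr_ge0.
  lra.
have : tilted_mean y <= expR (M * (y - x)) * tilted_mean x.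
  rewrite !tilted_meanE ler_pdivrMr ?ell_gt0// (le_trans le1)//.
  rewrite -mulrA ler_wpM2l ?expR_ge0// mulrAC ler_pdivlMr ?ell_gt0//.
  rewrite ler_wpM2l//; apply: Rintegral_ge0 => z; rewrite /D/= in_itv/= => /andP[z0 _].
  by rewrite mulr_ge0 ?expR_ge0// ltW.
have : expR (M * (y - x)) <= 1 + 2 * (M * (y - x)).
  by apply: expR_double_ge; rewrite hM mulr_ge0 ?subr_ge0// ltW.
move=> h1 h2; have h3 : expR (M * (y - x)) * tilted_mean x <=
   (1 + 2 * (M * (y - x))) * tilted_mean x by rewrite ler_wpM2r.
have : 0 <= (M - tilted_mean x) * (M * (y - x)).
  by rewrite mulr_ge0 ?subr_ge0 ?mulr_ge0 ?subr_ge0// ltW.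
rewrite expr2; lra.
Qed.

End bounded_support.

(** The condition in [expfam] with its natural parameter exposed, since tilts and divergences are
    computed in that parameter. *)
Definition is_member {R : realType}
    (m : {measure set (measurableTypeR R) -> \bar R}) (theta : R) (nu : real_law R) :=
  forall A, measurable A ->
    nu A = (\int[m]_(x in A) (expR (x * theta - log_partition m theta))%:E)%E.

(** * Moments and divergences of the members *)

Section members.
Context {R : realType}.
Variables (m : {measure set (measurableTypeR R) -> \bar R}) (M theta0 : R).
Let D : set (measurableTypeR R) := `]0, M]%classic.
Hypothesis M_gt0 : 0 < M.
Hypothesis m_supp : m (~` D) = 0%E.
Hypothesis laplace_theta0 : (0 < laplace m theta0 < +oo)%E.

Let mD : measurable D. Proof. exact: measurable_itv. Qed.

Local Notation b := (log_partition m).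
Local Notation mean := (tilted_mean m M).
Local Notation kl := (bregman b mean).

Let g (theta x : R) : R := expR (x * theta - b theta).

Let mg theta : measurable_fun setT (g theta : measurableTypeR R -> R).
Proof.
apply: measurableT_comp => //; apply: measurable_funB => //.
exact: measurable_funM.
Qed.

Let g_ge0 theta x : 0 <= g theta x. Proof. exact: expR_ge0. Qed.

Lemma member_integral theta nu (f : measurableTypeR R -> \bar R) :
  is_member m theta nu -> measurable_fun setT f -> (forall x, (0 <= f x)%E) ->
  (\int[nu]_x f x = \int[m]_x (f x * (g theta x)%:E))%E.
Proof. move=> nuE mf f0; exact: (ge0_integral_density (phi := id) _ (mg theta) (g_ge0 theta) nuE mf f0). Qed.

Lemma member_supp theta nu : is_member m theta nu -> nu (~` D) = 0%E.
Proof.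
move=> nuE; rewrite nuE; last exact: measurableC.
rewrite (@ge0_negligible_integral _ _ _ m (~` D) (~` D)).
- by rewrite setDv integral_set0.
- exact: measurableC.
- exact: measurableC.
- by apply/measurable_funTS/measurable_EFinP; exact: mg.
- by move=> x _; rewrite lee_fin g_ge0.
- exact: m_supp.
Qed.

Lemma member_mgf theta nu (lambda : R) : is_member m theta nu ->
  (\int[nu]_x (expR (lambda * x))%:E = (expR (b (theta + lambda) - b theta))%:E)%E.
Proof.
move=> nuE; rewrite (member_integral nuE); last 2 first.
- by apply/measurable_EFinP; apply: measurableT_comp => //; exact: measurable_funM.
- by move=> x; rewrite lee_fin expR_ge0.
transitivity (\int[m]_x ((expR (- b theta))%:E * (expR (x * (theta + lambda)))%:E))%E.
  apply: eq_integral => x _; rewrite -!EFinM /g -!expRD; congr (expR _)%:E; ring.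
rewrite ge0_integralZl_EFin; last 4 first.
- exact: measurableT.
- by move=> x _; rewrite lee_fin expR_ge0.
- by apply/measurable_EFinP; apply: measurableT_comp => //; exact: measurable_funM.
- exact: expR_ge0.
rewrite -/(laplace m (theta + lambda)) -(EFin_ell m_supp laplace_theta0).
rewrite -(expR_log_partition m_supp laplace_theta0) -EFinM -expRD.
by rewrite addrC.
Qed.

(** [member_integral] handles nonnegative functions, so the mean is computed through the positive
    part. *)
Let ae_pos theta nu : is_member m theta nu ->
  ae_eq nu setT (fun x : measurableTypeR R => (x : R)%:E) (fun x => (Num.max (x : R) 0)%:E).
Proof.
move=> nuE; exists (~` D); split; first exact: measurableC.
  exact: member_supp nuE.
move=> x /=; apply: contra_not; rewrite /D/= in_itv/= => /andP[x0 _] _.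
by rewrite max_l// ltW.
Qed.

Let integral_pos theta nu : is_member m theta nu ->
  (\int[nu]_x (Num.max (x : R) 0)%:E = (mean theta)%:E)%E.
Proof.
move=> nuE; have mmax : measurable_fun setT
    (fun x : measurableTypeR R => (Num.max (x : R) 0)%:E).
  by apply/measurable_EFinP; apply: measurable_maxr.
rewrite (member_integral nuE)//; last by move=> x; rewrite lee_fin le_max lexx orbT.
rewrite (@ge0_negligible_integral _ _ _ m setT (~` D)); last 5 first.
- exact: measurableC.
- exact: measurableT.
- by apply: emeasurable_funM => //; apply/measurable_EFinP; exact: mg.
- by move=> x _; rewrite mule_ge0// lee_fin ?g_ge0// le_max lexx orbT.
- exact: m_supp.
rewrite setTD setCK.
transitivity (\int[m]_(x in D) ((expR (- b theta))%:E * ((x * expR (x * theta))%:E)))%E.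
  apply: eq_integral => x; rewrite inE /D/= in_itv/= => /andP[x0 _].
  rewrite max_l; last exact: ltW.
  by rewrite -!EFinM /g expRD; congr (_)%:E; ring.
rewrite ge0_integralZl_EFin; last 4 first.
- exact: mD.
- by move=> x; rewrite /D/= in_itv/= => /andP[x0 _]; rewrite lee_fin mulr_ge0 ?expR_ge0 ?(ltW x0).
- apply/measurable_funTS/measurable_EFinP; apply: measurable_funM => //.
  by apply: measurableT_comp => //; exact: measurable_funM.
- exact: expR_ge0.
rewrite expRN (expR_log_partition m_supp laplace_theta0).
have -> : (\int[m]_(x in D) (x * expR (x * theta))%:E)%E = (ell1 m M theta)%:E.
  rewrite /ell1 /Rintegral fineK//.
  by apply: integrable_fin_num => //; exact: (integrable_expR1 M_gt0 m_supp laplace_theta0).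
by rewrite -EFinM mulrC unlock.
Qed.

Lemma member_expectation theta nu : is_member m theta nu ->
  (\int[nu]_x (x : R)%:E)%E = (mean theta)%:E.
Proof.
move=> nuE; rewrite -(integral_pos nuE); apply: ae_eq_integral => //.
- by apply/measurable_EFinP; apply: measurable_maxr.
- exact: ae_pos nuE.
Qed.

Lemma member_mean theta nu : is_member m theta nu -> law_mean nu = mean theta.
Proof. by move=> nuE; rewrite /law_mean unlock (member_expectation nuE). Qed.

Lemma member_integrable theta nu : is_member m theta nu ->
  nu.-integrable setT (EFin \o (fun x : measurableTypeR R => (x : R))).
Proof.
move=> nuE; apply/integrableP; split; first exact/measurable_EFinP.
rewrite (_ : (\int[nu]_x _)%E = (mean theta)%:E) ?ltry//.
rewrite -(integral_pos nuE); apply: ae_eq_integral => //.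
- by apply: measurableT_comp => //; exact/measurable_EFinP.
- by apply/measurable_EFinP; apply: measurable_maxr.
- have [N [mN N0 subN]] := ae_pos nuE; exists N; split => //.
  move=> x /= h; apply: subN => /=; apply: contra_not h => + _ => /(_ I) [xE].
  have x0 : 0 <= x by rewrite xE le_max lexx orbT.
  by rewrite ger0_norm// -xE.
Qed.

(** The log-density of [nu] relative to [nu'] is affine in the reward, so its expectation depends on
    [nu] only through the mean. *)
Lemma member_KLdiv theta theta' (nu nu' : real_law R) :
  is_member m theta nu -> is_member m theta' nu' ->
  KLdiv nu nu' = (kl theta theta')%:E.
Proof.
move=> nuE nuE'.
pose c := b theta - b theta'.
pose W (x : R) : R := expR ((theta - theta') * x - c).
have mW : measurable_fun setT (W : measurableTypeR R -> R).
  by apply: measurableT_comp => //; apply: measurable_funB => //.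
have nuW A : measurable A -> nu A = (\int[nu']_(x in A) (W x)%:E)%E.
  move=> mA; rewrite integral_mkcond (member_integral nuE'); last 2 first.
  - by apply/measurable_restrict => //; apply/measurable_funTS/measurable_EFinP.
  - by move=> x; apply: erestrict_ge0 => y _; rewrite lee_fin expR_ge0.
  rewrite nuE// integral_mkcond; apply: eq_integral => x _; rewrite !patchE.
  case: ifP => _; last by rewrite mul0e.
  rewrite -EFinM /W /g -expRD /c.
  by move: (b theta) (b theta') => u v; congr (expR _)%:E; ring.
have dom : nu `<< nu'.
  apply/null_content_dominatesP => A mA nuA0; rewrite nuW//.
  rewrite (@ge0_negligible_integral _ _ _ nu' A A)//.
  - by rewrite setDv integral_set0.
  - by apply/measurable_funTS/measurable_EFinP.
  - by move=> x _; rewrite lee_fin expR_ge0.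
(* Both functions integrate to [nu] against [nu'] on every measurable set, so they agree
   [nu']-almost everywhere; domination carries this over to [nu]. *)
have RNW : ae_eq nu setT ('d (charge_of_finite_measure nu) '/d nu') (fun x => (W x)%:E).
  apply: (null_dominates_ae_eq _ dom) => //.
  apply: integral_ae_eq => //.
  - exact: Radon_Nikodym_integrable.
  - exact/measurable_EFinP.
  - move=> A _ mA; rewrite -nuW//; symmetry.
    exact: (@Radon_Nikodym_integral _ _ _ (charge_of_finite_measure nu) nu' A dom mA).
have mRN : measurable_fun setT ('d (charge_of_finite_measure nu) '/d nu').
  by apply: measurable_int; exact: Radon_Nikodym_integrable.
rewrite /KLdiv unlock.
transitivity (\int[nu]_x ((theta - theta') * x - c)%:E)%E.
  apply: ae_eq_integral => //.
  - apply/measurable_EFinP; apply: measurableT_comp; first exact: measurable_ln.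
    by apply: measurableT_comp; first exact: fine_measurable.
  - by apply/measurable_EFinP; apply: measurable_funB.
  - have [N [mN N0 subN]] := RNW; exists N; split => //.
    move=> x /= h; apply: subN => /=; apply: contra_not h => + _ => /(_ I) ->.
    by rewrite /= expRK.
have iZ := integrableZl measurableT (theta - theta') (member_integrable nuE).
rewrite integralB_EFin//; last first.
  by apply: finite_measure_integrable_cst.
have -> : (\int[nu]_x c%:E = c%:E)%E by have := expectation_cst nu c; rewrite unlock.
have -> : (\int[nu]_x ((theta - theta') * x)%:E = (theta - theta')%:E * \int[nu]_x (x : R)%:E)%E.
  by rewrite -integralZl//; exact: (member_integrable nuE).
rewrite (member_expectation nuE) -EFinM -EFinB bregmanE /c.
by move: (b theta) (b theta') => u v; congr (_)%:E; ring.
Qed.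

End members.

Section family.
Context {R : realType}.
Variables (m : {measure set (measurableTypeR R) -> \bar R}) (M : R) (Theta : set R).
Hypothesis M_gt0 : 0 < M.
Hypothesis m_supp : m (~` (`]0, M]%classic : set (measurableTypeR R))) = 0%E.
Hypothesis reg : is_regular_expfam m Theta.

Local Notation b := (log_partition m).
Local Notation mean := (tilted_mean m M).

Lemma tilted_mean_increasing x y : Theta x -> Theta y -> x < y -> mean x < mean y.
Proof.
move=> Tx Ty; apply: (mu_increasing _ (param_interval reg) (log_partition_C2 reg)) => //.
exact: (log_partition_tangent M_gt0 m_supp (laplace_finite reg Tx)).
Qed.

Lemma tilted_mean_inj x y : Theta x -> Theta y -> mean x = mean y -> x = y.
Proof.
move=> Tx Ty xy; have [h|h|//] := ltgtP x y.
- by have := tilted_mean_increasing Tx Ty h; rewrite xy ltxx.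
- by have := tilted_mean_increasing Ty Tx h; rewrite xy ltxx.
Qed.

(** The choice in [KLmean] is determined: on [Theta] a mean has one natural parameter, and the two
    parameters fix the divergence. *)
Lemma KLmeanE theta theta' (nu nu' : real_law R) :
  Theta theta -> Theta theta' -> is_member m theta nu -> is_member m theta' nu' ->
  KLmean (expfam m Theta) (mean theta) (mean theta') = bregman b mean theta theta'.
Proof.
move=> Tt Tt' nuE nuE'; apply: get_unique.
  exists nu, nu'; split.
  - split; [by exists theta; [exact: Tt|exact: nuE]|].
    exact: (member_mean M_gt0 m_supp (laplace_finite reg Tt) nuE).
  - split; [by exists theta'; [exact: Tt'|exact: nuE']|].
    exact: (member_mean M_gt0 m_supp (laplace_finite reg Tt) nuE').
  - exact: (member_KLdiv M_gt0 m_supp (laplace_finite reg Tt) nuE nuE').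
move=> k [n [n' [[[t Tt1 nt] mn] [[t' Tt1' nt'] mn'] kE]]].
have mean_t := member_mean M_gt0 m_supp (laplace_finite reg Tt) nt.
have mean_t' := member_mean M_gt0 m_supp (laplace_finite reg Tt) nt'.
have tE : t = theta := tilted_mean_inj Tt1 Tt (etrans (esym mean_t) mn).
have tE' : t' = theta' := tilted_mean_inj Tt1' Tt' (etrans (esym mean_t') mn').
rewrite tE in nt; rewrite tE' in nt'.
have := member_KLdiv M_gt0 m_supp (laplace_finite reg Tt) nt nt'.
by rewrite kE => -[].
Qed.

End family.

(** * Counts and empirical means *)

Definition arm_sum {R : realType} {T : Type} {K : nat} (I : nat -> T -> 'I_K)
    (r : nat -> T -> R) (t : nat) (a : 'I_K) (w : T) : R :=
  \sum_(1 <= i < t.+1 | I i w == a) r i w.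

Lemma max_overP {R : realType} {K : nat} (f : 'I_K -> R) : (0 < K)%N ->
  exists2 o, max_over f = f o & forall a, f a <= f o.
Proof.
move=> K0; pose i0 : 'I_K := Ordinal K0.
have [c _ fc] := @arg_maxP _ R _ i0 xpredT f isT.
exists c => [|a]; last exact: fc.
apply/eqP; rewrite eq_le; apply/andP; split.
  by apply: ge_sup => [|_ [a _ <-]]; [exists (f c), c|exact: fc].
by apply: ub_le_sup; [exists (f c) => _ [a _ <-]; exact: fc|exists c].
Qed.

Section counts.
Context {R : realType} {T : Type} {K : nat}.
Variables (I : nat -> T -> 'I_K) (r : nat -> T -> R).

Lemma pulls0 a w : pulls I 0 a w = 0%N.
Proof. by rewrite /pulls big_geq. Qed.

Lemma arm_sum0 a w : arm_sum I r 0 a w = 0.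
Proof. by rewrite /arm_sum big_geq. Qed.

Lemma pullsS t a w : pulls I t.+1 a w = (pulls I t a w + (I t.+1 w == a))%N.
Proof. by rewrite /pulls big_nat_recr. Qed.

Lemma arm_sumS t a w :
  arm_sum I r t.+1 a w = arm_sum I r t a w + (if I t.+1 w == a then r t.+1 w else 0).
Proof. by rewrite /arm_sum big_mkcond big_nat_recr//= -big_mkcond. Qed.

Lemma pulls_le t a w : (pulls I t a w <= t)%N.
Proof.
elim: t => [|t IH]; first by rewrite pulls0.
by rewrite pullsS -addn1 leq_add// leq_b1.
Qed.

Lemma pulls_mono s t a w : (s <= t)%N -> (pulls I s a w <= pulls I t a w)%N.
Proof.
elim: t => [|t IH]; first by rewrite leqn0 => /eqP ->.
rewrite leq_eqVlt ltnS => /predU1P[->//|/IH /leq_trans]; apply.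
by rewrite pullsS leq_addr.
Qed.

Lemma arm_sum_pulls0 t a w : pulls I t a w = 0%N -> arm_sum I r t a w = 0.
Proof.
elim: t => [|t IH]; first by rewrite arm_sum0.
rewrite pullsS arm_sumS; case: eqP => [_|_]; first by rewrite addn1.
by rewrite addn0 addr0.
Qed.

Lemma emp_meanE t a w : (0 < pulls I t a w)%N ->
  arm_sum I r t a w = (pulls I t a w)%:R * emp_mean I r t a w.
Proof.
by move=> N0; rewrite /emp_mean mulrC divfK// pnatr_eq0 -lt0n.
Qed.

(* Each visit of arm [a] increases its count, so at most [u] of them start from
   a count below [u]. *)
Lemma count_below_le t a (u : nat) w :
  (\sum_(1 <= s < t.+1) ((I s w == a) && (pulls I s.-1 a w < u)) <= u)%N.
Proof.
suff : (\sum_(1 <= s < t.+1) ((I s w == a) && (pulls I s.-1 a w < u)) <=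
    minn u (pulls I t a w))%N by move=> /leq_trans; apply; exact: geq_minl.
elim: t => [|t IH]; first by rewrite big_geq.
rewrite big_nat_recr//= pullsS; case: eqP => _ /=; last by rewrite !addn0.
move: IH; move: (\sum_(1 <= s < t.+1) _)%N (pulls I t a w) => S N.
by case: (ltnP N u) => /=; lia.
Qed.

End counts.

Section counts_measurable.
Context {R : realType} {d : measure_display} {T : measurableType d} {K : nat}.
Variables (I : nat -> T -> 'I_K) (r : nat -> T -> R) (n : nat).
Hypothesis mI : forall i a, (1 <= i <= n)%N -> measurable (I i @^-1` [set a]).
Hypothesis mr : forall i, (1 <= i <= n)%N -> measurable_fun setT (r i).

Let mIb i a : (1 <= i <= n)%N -> measurable_fun setT (fun w => I i w == a).
Proof.
move=> hi; apply: (measurable_fun_bool true).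
rewrite setTI [X in measurable X](_ : _ = I i @^-1` [set a]); first exact: mI.
by apply/seteqP; split => w /= /eqP.
Qed.

Lemma pulls_measurable t a : (t <= n)%N -> measurable_fun setT (pulls I t a).
Proof.
elim: t => [|t IH] tn.
  by rewrite (_ : pulls I 0 a = cst 0%N)//; apply/funext => w; rewrite pulls0.
rewrite (_ : pulls I t.+1 a = (fun w => pulls I t a w + (if I t.+1 w == a then 1 else 0))%N).
  apply: measurable_fun_addn; first exact/IH/ltnW.
  by apply: measurable_fun_ifT => //; exact: mIb.
by apply/funext => w; rewrite pullsS; case: eqP.
Qed.

Lemma arm_sum_measurable t a : (t <= n)%N -> measurable_fun setT (arm_sum I r t a).
Proof.
elim: t => [|t IH] tn.
  by rewrite (_ : arm_sum I r 0 a = cst 0)//; apply/funext => w; rewrite arm_sum0.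
rewrite (_ : arm_sum I r t.+1 a =
  arm_sum I r t a \+ (fun w => if I t.+1 w == a then r t.+1 w else 0)).
  apply: measurable_funD; first exact/IH/ltnW.
  by apply: measurable_fun_ifT => //; [exact: mIb|exact: mr].
by apply/funext => w; rewrite arm_sumS.
Qed.

Lemma pulls_natr_measurable t a : (t <= n)%N ->
  measurable_fun setT (fun w => (pulls I t a w)%:R : R).
Proof.
move=> tn; apply: (@measurableT_comp _ _ _ _ _ _ (fun k : nat => k%:R : R)) => //.
exact: pulls_measurable.
Qed.

Lemma emp_mean_measurable t a : (t <= n)%N -> measurable_fun setT (emp_mean I r t a).
Proof.
move=> tn; rewrite (_ : emp_mean I r t a =
  (arm_sum I r t a \* (fun w => (fun k : nat => (k%:R)^-1 : R) (pulls I t a w)))%R)//.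
apply: measurable_funM; first exact: arm_sum_measurable.
apply: (@measurableT_comp _ _ _ _ _ _ (fun k : nat => (k%:R)^-1 : R)) => //.
exact: pulls_measurable.
Qed.

End counts_measurable.

(** * Runs of the algorithm *)

(** The generating class of [past], named so that the past becomes a measurable type to which
    measurability lemmas apply. *)
Definition past_generators {R : realType} {T : Type} {K : nat} (I : nat -> T -> 'I_K)
    (r : nat -> T -> R) (t : nat) : set (set T) :=
  [set A | exists2 i, (1 <= i < t)%N &
         (exists a, A = I i @^-1` [set a]) \/
         (exists2 B : set (measurableTypeR R), measurable B & A = r i @^-1` B)].

Section run.
Context {R : realType} {F : set (real_law R)} {L : nat -> R} {K : nat}
  {nu : 'I_K -> real_law R} {T : nat} {disp : measure_display}
  {Omega : measurableType disp} {P : probability Omega R}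
  {I : nat -> Omega -> 'I_K} {r : nat -> Omega -> R}.
Hypothesis run : is_expklms_run F L nu T P I r.

Local Notation pastT t := (g_sigma_algebraType (past_generators I r t)).
Local Notation N := (pulls I).
Local Notation S := (arm_sum I r).

Lemma past_arm t i a : (1 <= i <= t)%N -> measurable (I i @^-1` [set a] : set (pastT t.+1)).
Proof.
by move=> it; apply: sub_sigma_algebra; exists i => //; left; exists a.
Qed.

Lemma past_reward t i : (1 <= i <= t)%N ->
  measurable_fun setT (r i : pastT t.+1 -> R).
Proof.
move=> it _ B mB; rewrite setTI.
by apply: sub_sigma_algebra; exists i => //; right; exists B.
Qed.

Lemma past_measurable t H : (t <= T)%N -> past I r t.+1 H -> measurable H.
Proof.
move=> tT; apply: smallest_sub; first exact: sigma_algebra_measurable.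
move=> A [i /andP[i1 it] [[a ->]|[B mB ->]]].
  by apply: (arm_measurable run); rewrite i1 (leq_trans _ tT).
rewrite -[X in measurable X]setTI; apply: (reward_measurable run) => //.
by rewrite i1 (leq_trans _ tT).
Qed.

Lemma past_fun_measurable d' (Y : measurableType d') t (f : Omega -> Y) : (t <= T)%N ->
  measurable_fun setT (f : pastT t.+1 -> Y) -> measurable_fun setT f.
Proof.
move=> tT mf _ B mB; rewrite setTI; apply: (past_measurable tT).
by have := mf measurableT B mB; rewrite setTI.
Qed.

Lemma past_pulls t a : measurable_fun setT (N t a : pastT t.+1 -> nat).
Proof. by apply: (pulls_measurable (n := t)) => // i b; exact: past_arm. Qed.

Lemma past_pulls_natr t a : measurable_fun setT (fun w : pastT t.+1 => (N t a w)%:R : R).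
Proof.
by apply: (pulls_natr_measurable (n := t)) => // i b; exact: past_arm.
Qed.

Lemma past_arm_sum t a : measurable_fun setT (S t a : pastT t.+1 -> R).
Proof.
by apply: (arm_sum_measurable (n := t)) => // [i b|i]; [exact: past_arm|exact: past_reward].
Qed.

Lemma past_emp_mean t a : measurable_fun setT (emp_mean I r t a : pastT t.+1 -> R).
Proof.
by apply: (emp_mean_measurable (n := t)) => // [i b|i]; [exact: past_arm|exact: past_reward].
Qed.

Lemma past_pulls_gt0 t a : measurable ([set w | (0 < N t a w)%N] : set (pastT t.+1)).
Proof.
have := @past_pulls t a; move=> /(_ measurableT [set k | (0 < k)%N]).
by rewrite setTI; apply.
Qed.

Lemma expklms_prob_ge0 s a w : 0 <= expklms_prob F L I r s a w.
Proof.
rewrite /expklms_prob; case: ifP => // _.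
by rewrite divr_ge0 ?sumr_ge0// => *; exact: expR_ge0.
Qed.

Section arm_comparison.
Variables (t : nat) (H N0 : set Omega).
Hypothesis tT : (t < T)%N.
Hypothesis pastH : past I r t.+1 H.
Hypothesis mN0 : measurable N0.
Hypothesis PN0 : P N0 = 0%E.

Lemma arm_prob_compare a b c : 0 < c ->
  (forall w, H w -> ~ N0 w ->
    expklms_prob F L I r t.+1 a w <= c * expklms_prob F L I r t.+1 b w) ->
  (P (H `&` I t.+1 @^-1` [set a]) <= c%:E * P (H `&` I t.+1 @^-1` [set b]))%E.
Proof.
move=> c0 ab; rewrite !(arm_law run)//.
by apply: (ge0_le_integralZ c0 mN0 PN0) => // w Hw; exact: expklms_prob_ge0.
Qed.

Lemma arm_prob_le a c : 0 < c ->
  (forall w, H w -> ~ N0 w -> expklms_prob F L I r t.+1 a w <= c) ->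
  (P (H `&` I t.+1 @^-1` [set a]) <= c%:E)%E.
Proof.
move=> c0 ac; rewrite (arm_law run)//.
have mH := past_measurable (ltnW tT) pastH.
apply: (@le_trans _ _ (c%:E * \int[P]_(w in H) 1%:E)%E).
  apply: (@ge0_le_integralZ _ _ _ P H N0 _ (fun=> 1)) => // w Hw.
    exact: expklms_prob_ge0.
  by rewrite mulr1; exact: ac.
have -> : (\int[P]_(w in H) 1%:E = P H)%E by rewrite integral_cst// mul1e.
rewrite -[leRHS]mule1 lee_pmul2l//.
exact: probability_le1.
Qed.

End arm_comparison.

Let past_pulls_eq t a k : past I r t.+1 [set w | N t a w = k].
Proof.
by have := @past_pulls t a measurableT [set k]; rewrite setTI; apply.
Qed.

Let integral_split_pulls t a (H : set Omega) (f : Omega -> \bar R) : (t <= T)%N ->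
  measurable H -> measurable_fun setT f -> (forall w, (0 <= f w)%E) ->
  (\int[P]_(w in H) f w =
   \sum_(0 <= k < t.+1) \int[P]_(w in H `&` [set w | N t a w = k]) f w)%E.
Proof.
move=> tT mH mf f0.
have HU : H = \big[setU/set0]_(0 <= k < t.+1) (H `&` [set w | N t a w = k]).
  apply/seteqP; split => [w Hw|].
    rewrite -bigcup_seq; exists (N t a w) => //=.
    by rewrite mem_index_iota ltnS pulls_le.
  by rewrite -bigcup_seq => w [k _ []].
rewrite {1}HU ge0_integral_bigsetU//.
- by move=> k; apply: measurableI => //; apply: (past_measurable tT); exact: past_pulls_eq.
- exact: iota_uniq.
- by move=> i j _ _ [w [[_ <-] [_ <-]]].
- by rewrite -HU; exact: measurable_funTS.
Qed.

(** On each slice where the count of [b] equals [k] the factor is constant and the slice belongs to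
    the past, so [arm_prob_compare] applies slice by slice. *)
Lemma arm_prob_le_integral t a b (H N0 : set Omega) (c : R) : (t < T)%N ->
  past I r t.+1 H -> measurable N0 -> P N0 = 0%E ->
  (forall w, H w -> ~ N0 w -> expklms_prob F L I r t.+1 a w <=
    expR (c * (N t b w)%:R) * expklms_prob F L I r t.+1 b w) ->
  (P (H `&` I t.+1 @^-1` [set a]) <=
    \int[P]_(w in H `&` I t.+1 @^-1` [set b]) (expR (c * (N t b w)%:R))%:E)%E.
Proof.
move=> tT pastH mN0 PN0 ab; have tT' := ltnW tT.
have mH := past_measurable tT' pastH.
have mI x : measurable (I t.+1 @^-1` [set x]) by exact: (arm_measurable run).
have mc : measurable_fun setT (fun w => (expR (c * (N t b w)%:R))%:E).
  apply/measurable_EFinP; apply: measurableT_comp => //; apply: measurable_funM => //.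
  by apply: (past_fun_measurable tT'); exact: past_pulls_natr.
have mHI x : measurable (H `&` I t.+1 @^-1` [set x]) by exact: measurableI.
have -> : P (H `&` I t.+1 @^-1` [set a]) =
    (\int[P]_(w in H `&` I t.+1 @^-1` [set a]) 1%:E)%E.
  by rewrite integral_cst// mul1e.
rewrite (integral_split_pulls b tT' (mHI a))//.
rewrite (integral_split_pulls b tT' (mHI b))//.
apply: lee_sum => k _; set Z := [set w | _].
have pZ : past I r t.+1 Z by exact: past_pulls_eq.
have mZ := past_measurable tT' pZ.
have pHZ : past I r t.+1 (H `&` Z).
  exact: (@measurableI _ (pastT t.+1) _ _ pastH pZ).
have mk x : measurable (H `&` I t.+1 @^-1` [set x] `&` Z) by apply: measurableI.
have -> : (\int[P]_(w in H `&` I t.+1 @^-1` [set b] `&` Z) (expR (c * (N t b w)%:R))%:E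
    = (expR (c * k%:R))%:E * P (H `&` I t.+1 @^-1` [set b] `&` Z))%E.
  rewrite -integral_cst//; apply: eq_integral => w /set_mem [_ <-] //.
rewrite integral_cst// mul1e -!(setIAC H Z).
apply: (arm_prob_compare tT pHZ mN0 PN0); first exact: expR_gt0.
by move=> w [Hw <-]; exact: ab.
Qed.

(** * Telescoping of the tilted process *)

Section tilt.
Variables (a : 'I_K) (lambda phi delta : R).
Hypothesis delta_gt0 : 0 < delta.
Hypothesis mgf : (\int[nu a]_x (expR (lambda * x))%:E = (expR phi)%:E)%E.

Let Y t w : R := expR (lambda * S t a w - (phi + delta) * (N t a w)%:R).

(* [pot] is [Y], except that the first pull of [a] is already paid for. *)
Let pot t w : R := if (0 < N t a w)%N then Y t w else expR (- delta).

Let pastY t : measurable_fun setT (Y t : pastT t.+1 -> R).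
Proof.
apply: measurableT_comp => //; apply: measurable_funB.
  by apply: measurable_funM => //; exact: past_arm_sum.
by apply: measurable_funM => //; exact: past_pulls_natr.
Qed.

Let mY t : (t <= T)%N -> measurable_fun setT (Y t).
Proof. by move=> tT; apply: (past_fun_measurable tT); exact: pastY. Qed.

Let mpos t : (t <= T)%N -> measurable [set w | (0 < N t a w)%N].
Proof. by move=> tT; apply: (past_measurable tT); exact: past_pulls_gt0. Qed.

Let mD t : (t < T)%N -> measurable (I t.+1 @^-1` [set a]).
Proof. by move=> tT; exact: (arm_measurable run). Qed.

Let mpot t : (t <= T)%N -> measurable_fun setT (pot t).
Proof.
move=> tT; apply: measurable_fun_ifT => //; last exact: mY.
apply: (measurable_fun_bool true); rewrite setTI.
exact: mpos.
Qed.

(** A pull multiplies [Y] by [expR (- delta)] and by a likelihood factor of the fresh reward, whose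
    mean given the past is 1. *)
Let pull_integral t : (t < T)%N ->
  (\int[P]_(w in I t.+1 @^-1` [set a]) (pot t.+1 w)%:E =
   (expR (- delta))%:E * \int[P]_(w in I t.+1 @^-1` [set a]) (Y t w)%:E)%E.
Proof.
move=> tT; set D := _ @^-1` _.
pose g (x : measurableTypeR R) : R := expR (lambda * x - phi).
have mg : measurable_fun setT g.
  apply: measurableT_comp => //; apply: measurable_funB => //.
have Dpot w : D w -> pot t.+1 w = expR (- delta) * (Y t w * g (r t.+1 w)).
  rewrite /D /= => Ia; rewrite /pot /Y /g pullsS arm_sumS Ia eqxx addn1 /=.
  by rewrite -!expRD; congr expR; rewrite -natr1; ring.
under eq_integral => w /set_mem Dw do rewrite Dpot// EFinM.
have mYg : measurable_fun D (fun w => Y t w * g (r t.+1 w)).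
  apply: measurable_funTS; apply: measurable_funM; first exact/mY/ltnW.
  by apply: measurableT_comp => //; exact: (reward_measurable run).
rewrite ge0_integralZl_EFin ?expR_ge0//; last 3 first.
- exact: mD.
- by move=> w _; rewrite lee_fin mulr_ge0 ?expR_ge0.
- exact/measurable_EFinP.
congr (_ * _)%E; apply: (integral_indep (nu := nu a)) => //.
- exact: mD.
- exact/mY/ltnW.
- exact: (reward_measurable run).
- by move=> x; rewrite expR_ge0.
- by move=> w; rewrite expR_ge0.
- move=> A B mA mB; apply: (reward_law run) => //.
  by have := @pastY t measurableT A mA; rewrite setTI.
- transitivity (\int[nu a]_x ((expR (- phi))%:E * (expR (lambda * x))%:E))%E.
    by apply: eq_integral => x _; rewrite -EFinM /g expRD mulrC.
  rewrite ge0_integralZl_EFin; last 4 first.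
  - exact: measurableT.
  - by move=> x _; rewrite lee_fin expR_ge0.
  - by apply/measurable_EFinP; apply: measurableT_comp.
  - exact: expR_ge0.
  by rewrite mgf -EFinM -expRD addNr expR0.
Qed.

(** The expected potential drops by the share [1 - expR (- delta)] of [Y] at each pull with positive
    count. At the first pull [Y] is 1 and the potential already equals [expR (- delta)], so nothing
    is lost. *)
Let step t : (t < T)%N ->
  (\int[P]_w (pot t.+1 w)%:E + (1 - expR (- delta))%:E *
     \int[P]_(w in I t.+1 @^-1` [set a] `&` [set w | (0 < N t a w)%N]) (Y t w)%:E =
   \int[P]_w (pot t w)%:E)%E.
Proof.
move=> tT; set D := _ @^-1` _; set Z := [set w | _].
have mDt : measurable D := mD tT.
have mZ : measurable Z := mpos (ltnW tT).
have pot0 s w : (0 <= (pot s w)%:E)%E by rewrite lee_fin /pot /Y; case: ifP => _; exact: expR_ge0.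
have Y0 s w : (0 <= (Y s w)%:E)%E by rewrite lee_fin expR_ge0.
have mYt : measurable_fun setT (Y t) by apply: mY; exact: ltnW.
have eY : measurable_fun setT (fun w => (Y t w)%:E) by apply/measurable_EFinP.
have epot s : (s <= T)%N -> measurable_fun setT (fun w => (pot s w)%:E).
  by move=> sT; apply/measurable_EFinP; exact: mpot.
have splitD (f : Omega -> \bar R) (A B : set Omega) : measurable A -> measurable B ->
    measurable_fun setT f -> (forall w, (0 <= f w)%E) ->
    (\int[P]_(w in A) f w = \int[P]_(w in A `&` B) f w + \int[P]_(w in A `\` B) f w)%E.
  move=> mA mB mf f0; rewrite -{1}(setUIDK A B) ge0_integral_setU//.
  - exact: measurableI.
  - exact: measurableD.
  - exact: measurable_funTS.
  - by rewrite disj_set2E setDE setIACA setICr setI0.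
have sT (f : Omega -> \bar R) := splitD f setT D measurableT mDt.
rewrite (sT _ (epot _ tT))// (sT _ (epot _ (ltnW tT)))// !setTI !setTD.
have -> : (\int[P]_(w in ~` D) (pot t.+1 w)%:E = \int[P]_(w in ~` D) (pot t w)%:E)%E.
  apply: eq_integral => w /set_mem Dw; congr EFin; rewrite /pot /Y pullsS arm_sumS.
  by case: eqP => [Ia|_]; [exfalso; exact: Dw|rewrite addn0 addr0].
have /= sY := splitD (fun w => (Y t w)%:E) D Z mDt mZ eY (Y0 t).
have /= sP := splitD (fun w => (pot t w)%:E) D Z mDt mZ (epot t (ltnW tT)) (pot0 t).
rewrite pull_integral// sY sP.
have -> : (\int[P]_(w in D `&` Z) (pot t w)%:E = \int[P]_(w in D `&` Z) (Y t w)%:E)%E.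
  by apply: eq_integral => w /set_mem [_ Zw]; rewrite /pot Zw.
have -> : (\int[P]_(w in D `\` Z) (pot t w)%:E =
    (expR (- delta))%:E * \int[P]_(w in D `\` Z) (Y t w)%:E)%E.
  rewrite -ge0_integralZl_EFin//; last 2 first.
  - exact: measurableD.
  - exact: measurable_funTS.
  apply: eq_integral => w /set_mem [_ /negP]; rewrite -leqNgt leqn0 => /eqP N0.
  by rewrite /pot /Y N0 arm_sum_pulls0//= !mulr0 subr0 expR0 mule1.
set A := (\int[P]_(w in D `&` Z) _)%E; set B := (\int[P]_(w in D `\` Z) _)%E.
have A0 : (0 <= A)%E by exact: integral_ge0.
have B0 : (0 <= B)%E by exact: integral_ge0.
rewrite -addeA addeCA addeC; congr (_ + _)%E.
have q01 : 0 <= 1 - expR (- delta) by rewrite subr_ge0 -expR0 ler_expR oppr_le0 ltW.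
rewrite ge0_muleDr// addeAC -ge0_muleDl ?lee_fin ?expR_ge0//.
by rewrite -EFinD addrCA subrr addr0 mul1e.
Qed.

(** The potential starts at [expR (- delta)], so the telescoped sum is at most 1 / (exp(delta) - 1),
    hence at most 1 / delta. *)
Lemma tilted_pulls :
  (\sum_(0 <= t < T)
     \int[P]_(w in I t.+1 @^-1` [set a] `&` [set w | (0 < N t a w)%N])
       (expR (lambda * S t a w - (phi + delta) * (N t a w)%:R))%:E <= delta^-1%:E)%E.
Proof.
pose q := expR (- delta).
have q1 : 0 < 1 - q by rewrite subr_gt0 -expR0 ltr_expR oppr_lt0.
have telescope n : (n <= T)%N -> (\int[P]_w (pot n w)%:E + (1 - q)%:E *
    \sum_(0 <= t < n)
     \int[P]_(w in I t.+1 @^-1` [set a] `&` [set w | (0 < N t a w)%N]) (Y t w)%:E =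
    q%:E)%E.
  elim: n => [_|n IH nT].
    rewrite big_geq// mule0 adde0.
    under eq_integral => w _ do rewrite /pot pulls0 /=.
    by have := expectation_cst P q; rewrite unlock.
  rewrite big_nat_recr//= ge0_muleDr; last 2 first.
  - by apply: sume_ge0 => t _; apply: integral_ge0 => w _; rewrite lee_fin expR_ge0.
  - by apply: integral_ge0 => w _; rewrite lee_fin expR_ge0.
  by rewrite addeCA step// addeC IH// ltnW.
have pT0 : (0 <= \int[P]_w (pot T w)%:E)%E.
  by apply: integral_ge0 => w _; rewrite lee_fin /pot /Y; case: ifP => _; exact: expR_ge0.
have : ((1 - q)%:E * \sum_(0 <= t < T)
     \int[P]_(w in I t.+1 @^-1` [set a] `&` [set w | (0 < N t a w)%N]) (Y t w)%:E <=
    q%:E)%E by rewrite -(telescope T)// leeDr.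
rewrite muleC -lee_pdivlMr// => /le_trans; apply.
rewrite -EFinM lee_fin ler_pdivrMr// ler_pdivlMl//.
have : q * (1 + delta) <= 1.
  by rewrite /q expRN ler_pdivrMl ?expR_gt0// mulr1 expR_ge1Dx.
lra.
Qed.

End tilt.
End run.

(** * Geometric levels *)

Section levels.
Context {R : realType}.
Variables (d eta : R).
Hypothesis d_gt1 : 1 < d.
Hypothesis eta_gt0 : 0 < eta.

(** Above 1, so that the levels grow; below [d], so that [level j.+1 / d] stays a fixed fraction
    below [level j + eta]. *)
Definition level_ratio : R := (1 + d) / 2.
(** The shift makes level 0 equal to 0 while [level j + eta] is exactly geometric. *)
Definition level (j : nat) : R := eta * (level_ratio ^+ j - 1).

(* The decay rate of the tilted process at level [j]: the Chernoff exponent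
   [level j + eta], minus the at most [level j.+1 / d] spent on comparing the
   sampling probabilities. *)
Definition level_gain (j : nat) : R := level j + eta - level j.+1 / d.
(** [eta] times the sum of the geometric series that bounds the inverse gains. *)
Definition level_cst : R :=
  level_ratio / ((level_ratio - 1) * (1 - level_ratio / d)).

Let d_gt0 : 0 < d. Proof. exact: lt_trans ltr01 d_gt1. Qed.

Lemma level_ratio_gt1 : 1 < level_ratio.
Proof. by rewrite /level_ratio ltr_pdivlMr // mul1r; move: d_gt1; lra. Qed.

Let ratio_gt0 : 0 < level_ratio. Proof. exact: lt_trans ltr01 level_ratio_gt1. Qed.

Let gamma_gt0 : 0 < 1 - level_ratio / d.
Proof.
by rewrite subr_gt0 ltr_pdivrMr// mul1r /level_ratio ltr_pdivrMr//; move: d_gt1; lra.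
Qed.

Lemma level_cst_gt0 : 0 < level_cst.
Proof. by rewrite divr_gt0// mulr_gt0// subr_gt0 level_ratio_gt1. Qed.

Lemma level_ge0 j : 0 <= level j.
Proof. by rewrite mulr_ge0 ?(ltW eta_gt0)// subr_ge0 exprn_ege1// ltW// level_ratio_gt1. Qed.

Lemma level_gain_ge j : eta * (1 - level_ratio / d) * level_ratio ^+ j <= level_gain j.
Proof.
have -> : level_gain j = eta * (1 - level_ratio / d) * level_ratio ^+ j + eta / d.
  by rewrite /level_gain /level exprS; field; rewrite gt_eqF.
by rewrite lerDl divr_ge0// ltW.
Qed.

Lemma level_gain_gt0 j : 0 < level_gain j.
Proof.
apply: lt_le_trans (level_gain_ge j).
by rewrite !mulr_gt0// exprn_gt0.
Qed.

Lemma level_exists z : 0 <= z -> exists j, level j <= z < level j.+1.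
Proof.
move=> z0; have ratio1 : 0 < level_ratio - 1 by rewrite subr_gt0 level_ratio_gt1.
have bernoulli n : 1 + n%:R * (level_ratio - 1) <= level_ratio ^+ n.
  elim: n => [|n IH]; first by rewrite mul0r addr0 expr0.
  rewrite exprS -natr1.
  have : level_ratio * (1 + n%:R * (level_ratio - 1)) <= level_ratio * level_ratio ^+ n.
    by rewrite ler_wpM2l// ltW.
  have : 0 <= n%:R * (level_ratio - 1) ^+ 2 by rewrite mulr_ge0// sqr_ge0.
  rewrite expr2; lra.
have [n zn] : exists n, z < level n.
  exists (Num.truncn (z / (eta * (level_ratio - 1)))).+1.
  set n := _.+1; have : z / (eta * (level_ratio - 1)) < n%:R.
    by apply: (proj2 (andP (truncn_itv _))); rewrite divr_ge0 ?mulr_ge0// ltW.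
  rewrite ltr_pdivrMr ?mulr_gt0// => /lt_le_trans; apply.
  rewrite mulrCA /level ler_wpM2l ?(ltW eta_gt0)//.
  by have := bernoulli n; lra.
have [j /andP[zj jmin]] : exists j, (z < level j) && [forall i : 'I_j, level i <= z].
  case: (ex_minnP (ex_intro (fun n => z < level n) n zn)) => j zj jmin.
  exists j; rewrite zj; apply/forallP => i; rewrite leNgt; apply/negP => /jmin.
  by rewrite leqNgt ltn_ord.
case: j zj jmin => [|j] zj jmin.
  by move: zj; rewrite /level expr0 subrr mulr0 ltNge z0.
by exists j; rewrite zj andbT; have /forallP/(_ ord_max) := jmin.
Qed.

Lemma sum_level_gain_le n : \sum_(0 <= j < n) (level_gain j)^-1 <= level_cst / eta.
Proof.
pose z := level_ratio^-1.
have z1 : z < 1 by rewrite invf_lt1 ?level_ratio_gt1.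
have z0 : 0 < z by rewrite invr_gt0.
have k0 : 0 < eta * (1 - level_ratio / d) by rewrite mulr_gt0.
apply: (@le_trans _ _ (\sum_(0 <= j < n) ((eta * (1 - level_ratio / d))^-1 * z ^+ j))).
  apply: ler_sum => j _; rewrite /z exprVn -invfM lef_pV2 ?posrE ?level_gain_gt0//.
    exact: level_gain_ge.
  by rewrite mulr_gt0 ?exprn_gt0.
rewrite -mulr_sumr big_mkord.
have zn : \sum_(i < n) z ^+ i <= (1 - z)^-1.
  have z1' : 0 < 1 - z by rewrite subr_gt0.
  rewrite -[leRHS]mul1r ler_pdivlMr//.
  have : 0 <= z ^+ n by rewrite exprn_ge0// ltW.
  have := subrX1 z n; lra.
apply: (@le_trans _ _ ((eta * (1 - level_ratio / d))^-1 * (1 - z)^-1)).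
  by rewrite ler_wpM2l// invr_ge0 ltW.
rewrite le_eqVlt; apply/orP; left; apply/eqP; rewrite /level_cst /z.
have r1 := level_ratio_gt1; field.
have rd : level_ratio < d by move: gamma_gt0; rewrite subr_gt0 ltr_pdivrMr// mul1r.
by rewrite !gt_eqF// subr_gt0.
Qed.

End levels.

(** * Regret *)

Lemma inv_antitone {R : realType} (q k : R) : 0 < q -> q <= k -> k^-1 <= q^-1.
Proof. by move=> q0 qk; rewrite lef_pV2// posrE (lt_le_trans q0). Qed.

Lemma third_le {R : realType} (p D : R) : 0 < D -> p <= p + D / 3 <= p + D.
Proof. by move=> D0; apply/andP; split; lra. Qed.

Lemma two_thirds_le {R : realType} (p D : R) : 0 < D ->
  p + D / 3 <= p + D - D / 3 <= p + D.
Proof. by move=> D0; apply/andP; split; lra. Qed.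

Lemma third_diff {R : realType} (p D : R) : p + D - D / 3 - (p + D / 3) = D / 3.
Proof. by field. Qed.

Lemma third_sqr_le {R : realType} (D k m2 : R) :
  (D / 3) ^+ 2 <= 4 * (2 * m2) * k -> D ^+ 2 <= k * (72 * m2).
Proof. rewrite !expr2; lra. Qed.

Section bandit.
Context {R : realType} {m : {measure set (measurableTypeR R) -> \bar R}}
  {M d : R} {Theta : set R} {K T : nat}
  {nu : 'I_K -> real_law R} {disp : measure_display}
  {Omega : measurableType disp} {P : probability Omega R}
  {I : nat -> Omega -> 'I_K} {r : nat -> Omega -> R}.
Local Notation F := (expfam m Theta).
Local Notation L := (fun k : nat => k%:R / d : R).
Hypothesis M_gt0 : 0 < M.
Hypothesis d_gt1 : 1 < d.
Hypothesis reg : is_regular_expfam m Theta.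
Hypothesis means : forall n, F n -> 0 < law_mean n <= M.
Hypothesis K_gt0 : (0 < K)%N.
Hypothesis T_gt0 : (0 < T)%N.
Hypothesis nuF : forall a, F (nu a).
Hypothesis run : is_expklms_run F L nu T P I r.
Hypothesis empF : emp_means_in_family F T P I r.

Local Notation D := (`]0, M]%classic : set (measurableTypeR R)).
Local Notation b := (log_partition m).
Local Notation mean := (tilted_mean m M).
Local Notation kl := (bregman b mean).
Local Notation N := (pulls I).
Local Notation S := (arm_sum I r).
Local Notation emp := (emp_mean I r).

Lemma first_arms t a : (1 <= t <= T)%N -> (t <= K)%N ->
  P (I t @^-1` [set a]) = ((a.+1 == t)%:R)%:E.
Proof.
move=> tT tK; rewrite -[X in P X]setTI (arm_law run)//; last first.
  by rewrite -setC0; apply: sigma_algebraC; exact: sigma_algebra0.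
under eq_integral do rewrite /expklms_prob tK.
by have := expectation_cst P ((a.+1 == t)%:R); rewrite unlock.
Qed.

(* The first reward is an empirical mean, hence a mean of a member. *)
Lemma base_supp : m (~` D) = 0%E.
Proof.
pose a0 := Ordinal K_gt0.
have mDC : measurable (~` D) by apply: measurableC; exact: measurable_itv.
have t1 : (1 <= 1 <= T)%N by [].
have pT : past I r 1 setT.
  by rewrite -setC0; apply: sigma_algebraC; exact: sigma_algebra0.
have Pa0 : P (I 1 @^-1` [set a0]) = 1%E by rewrite first_arms.
have nu0 : nu a0 (~` D) = 0%E.
  have := reward_law run a0 t1 pT mDC.
  rewrite setTI Pa0 mul1e => <-.
  have [N0 [mN0 PN0 sub]] := empF.
  apply: (subset_measure0 _ mN0 _ PN0).
    apply: measurableI; first exact: (arm_measurable run).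
    by rewrite -[X in measurable X]setTI; apply: (reward_measurable run).
  move=> w [/= Iw rw]; apply: sub => /= /(_ 1%N a0 t1).
  have p1 : N 1 a0 w = 1%N by rewrite pullsS pulls0 Iw eqxx.
  rewrite p1 => /(_ isT) [n Fn].
  rewrite /emp_mean -/(S 1 a0 w) p1 divr1 arm_sumS arm_sum0 add0r Iw eqxx => nE.
  by apply: rw; rewrite /= in_itv/= -nE; exact: means.
have [theta Ttheta nuE] := nuF a0.
have mg : measurable_fun (~` D) (fun x : measurableTypeR R =>
    (expR (x * theta - b theta))%:E).
  apply: measurable_funTS; apply/measurable_EFinP; apply: measurableT_comp => //.
  by apply: measurable_funB => //; exact: measurable_funM.
(* The density of a member is positive everywhere, so a null set of the member is null for [m]. *)
have : (\int[m]_(x in ~` D) `|(expR (x * theta - b theta))%:E| = 0)%E.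
  by rewrite -[RHS]nu0 nuE//; apply: eq_integral => x _; rewrite gee0_abs ?lee_fin ?expR_ge0.
move=> /(ae_eq_integral_abs _ mDC mg) [N0 [mN0 N00 sub]].
apply: (subset_measure0 mDC mN0 _ N00) => x Dx; apply: sub => /= /(_ Dx) /eqP.
by rewrite eqe gt_eqF// expR_gt0.
Qed.

Let lap theta : Theta theta -> (0 < laplace m theta < +oo)%E.
Proof. exact: (laplace_finite reg). Qed.

(* [w] is good if all empirical means are means of members and the first
   rounds pull the arms in turn. *)
Definition good (w : Omega) : Prop :=
  (forall t a, (1 <= t <= T)%N -> (0 < N t a w)%N ->
     exists n theta, [/\ Theta theta, is_member m theta n & emp t a w = mean theta]) /\
  (forall a : 'I_K, (a < T)%N -> I a.+1 w = a).

Lemma good_ae : exists N0, [/\ measurable N0, P N0 = 0%E & forall w, ~ N0 w -> good w].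
Proof.
have [N1 [mN1 PN1 sub1]] := empF.
pose E (a : 'I_K) : set Omega := if (a < T)%N then ~` (I a.+1 @^-1` [set a]) else set0.
have mE a : measurable (E a).
  rewrite /E; case: ifP => // aT; apply: measurableC.
  exact: (arm_measurable run).
have PE a : P (E a) = 0%E.
  rewrite /E; case: ifP => aT; last by rewrite measure0.
  rewrite probability_setC; last exact: (arm_measurable run).
  by rewrite first_arms// eqxx subee.
pose N2 := \big[setU/set0]_(a < K) E a.
have [mN2 PN2] : measurable N2 /\ P N2 = 0%E.
  apply: (@big_ind _ (fun A => measurable A /\ P A = 0%E)) => [||a _]; last by split.
    by split; [exact: measurable0|exact: measure0].
  move=> A B [mA A0] [mB B0]; split; first exact: measurableU.
  by rewrite measureU0.
exists (N1 `|` N2); split.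
- exact: measurableU.
- by rewrite measureU0.
- move=> w /not_orP[w1 w2]; split.
    move=> t a tT Na; have : ~ ~ (forall t a, (1 <= t <= T)%N -> (0 < N t a w)%N ->
        (law_mean @` F) (emp t a w)) by apply: contra_not w1 => h; exact: sub1.
    move=> /contrapT /(_ t a tT Na) [n [theta Tt nE] <-].
    exists n, theta; split => //.
    exact: (member_mean M_gt0 base_supp (lap Tt) nE).
  move=> a aT; apply: contrapT => Ia; apply: w2.
  by rewrite /N2 -bigcup_seq; exists a; [exact: mem_index_enum|rewrite /E aT].
Qed.

Lemma family_nonempty : exists theta, Theta theta.
Proof. by have [theta Tt _] := nuF (Ordinal K_gt0); exists theta. Qed.

Lemma b_tangent x y : b x + mean x * (y - x) <= b y.
Proof.
by have [theta Tt] := family_nonempty; exact: (log_partition_tangent M_gt0 base_supp (lap Tt)).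
Qed.

Lemma mean_bounds x : 0 <= mean x <= M.
Proof.
by have [theta Tt] := family_nonempty; exact: (tilted_mean_bounds M_gt0 base_supp (lap Tt)).
Qed.

Lemma mean_lip x y : x <= y -> mean y - mean x <= 2 * M ^+ 2 * (y - x).
Proof.
by have [theta Tt] := family_nonempty; exact: (tilted_mean_lip M_gt0 base_supp (lap Tt)).
Qed.

Lemma L_gt0 : 0 < 2 * M ^+ 2.
Proof. by rewrite mulr_gt0// exprn_gt0. Qed.

Lemma mean_lt_inv x y : mean x < mean y -> x < y.
Proof.
by apply: contraTT; rewrite -!leNgt; exact: (mu_nondecreasing b_tangent).
Qed.

(** Inverting a weak inequality takes strict monotonicity, hence parameters in [Theta];
    [mean_lt_inv] is free of that restriction. *)
Lemma mean_le_inv x y : Theta x -> Theta y -> mean x <= mean y -> x <= y.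
Proof.
move=> Tx Ty; apply: contraTT; rewrite -!ltNge.
exact: (tilted_mean_increasing M_gt0 base_supp reg).
Qed.

(** * Sampling probabilities on good outcomes *)

Section good_round.
Variables (t : nat) (w : Omega).
Hypothesis Kt : (K <= t < T)%N.
Hypothesis good_w : good w.

Local Notation weight a := (expklms_weight F L I r t.+1 a w).
Local Notation prob a := (expklms_prob F L I r t.+1 a w).

Lemma good_pulls a : (0 < N t a w)%N.
Proof.
have [_ goodI] := good_w; have /andP[Kt' tT] := Kt.
(* Arm [a] is pulled in round [a.+1], which is at most [K] and hence at most [t]. *)
apply: (@leq_trans (N a.+1 a w)).
  by rewrite pullsS goodI ?eqxx ?addn1// (leq_trans (ltn_ord a))// (leq_trans Kt')// ltnW.
by apply: pulls_mono; rewrite (leq_trans (ltn_ord a)).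
Qed.

Lemma good_KL a : exists theta theta', [/\ Theta theta, Theta theta',
  emp t a w = mean theta,
  (forall c, emp t c w <= mean theta') /\ (exists c, emp t c w = mean theta') &
  KLmean F (emp t a w) (max_over (fun c => emp t c w)) = kl theta theta'].
Proof.
have [goodE _] := good_w; have /andP[Kt' tT] := Kt.
have [c maxE cmax] := max_overP (fun c => emp t c w) K_gt0.
have t1 : (1 <= t <= T)%N by rewrite (leq_trans K_gt0)// ltnW.
have [n [theta [Tt nE aE]]] := goodE t a t1 (good_pulls a).
have [n' [theta' [Tt' nE' cE]]] := goodE t c t1 (good_pulls c).
exists theta, theta'; split => //.
- by split => [c'|]; [rewrite -cE; exact: cmax|exists c].
- by rewrite maxE aE cE (KLmeanE M_gt0 base_supp reg Tt Tt' nE nE').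
Qed.

Lemma good_probE a : prob a = weight a / \sum_(c < K) weight c.
Proof. by rewrite /expklms_prob ltnNge; case/andP: Kt => ->. Qed.

Lemma good_weight_le1 a : weight a <= 1.
Proof.
have [theta [theta' [_ _ _ _ klE]]] := good_KL a.
rewrite /expklms_weight/= klE -[leRHS]expR0 ler_expR oppr_le0 mulr_ge0 ?divr_ge0//.
  by rewrite ltW// (lt_trans _ d_gt1).
exact: (bregman_ge0 b_tangent).
Qed.

Lemma sum_weight_gt0 : 0 < \sum_(c < K) weight c.
Proof.
rewrite (bigD1 (Ordinal K_gt0))//= ltr_pwDl ?expR_gt0//.
by apply: sumr_ge0 => c _; exact: expR_ge0.
Qed.

(** The normaliser cancels and the weight of [a] is at most 1, so only the inverse weight of [o]
    remains. *)
Lemma good_prob_compare a o kappa :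
  KLmean F (emp t o w) (max_over (fun c => emp t c w)) <= kappa ->
  prob a <= expR (kappa / d * (N t o w)%:R) * prob o.
Proof.
move=> klo; rewrite !good_probE mulrA ler_wpM2r ?invr_ge0 ?(ltW sum_weight_gt0)//.
apply: (le_trans (good_weight_le1 a)); rewrite /expklms_weight/= -expRD -[leLHS]expR0 ler_expR.
have -> : kappa / d * (N t o w)%:R = (N t o w)%:R / d * kappa by ring.
by rewrite subr_ge0 ler_wpM2l// divr_ge0// ltW// (lt_trans _ d_gt1).
Qed.

Lemma good_prob_le a kappa :
  kappa <= KLmean F (emp t a w) (max_over (fun c => emp t c w)) ->
  prob a <= expR (- ((N t a w)%:R / d * kappa)).
Proof.
move=> kla; rewrite good_probE ler_pdivrMr ?sum_weight_gt0//.
(* The arm with the largest empirical mean has divergence 0 and weight 1. *)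
have sum1 : 1 <= \sum_(c < K) weight c.
  have [c maxE cmax] := max_overP (fun c => emp t c w) K_gt0.
  rewrite (bigD1 c)//= -[leLHS]addr0 lerD//; last first.
    by apply: sumr_ge0 => c' _; exact: expR_ge0.
  have [theta [theta' [Tt Tt' cE [ub [c' c'E]] klE]]] := good_KL c.
  have tE : theta' = theta.
    apply: (tilted_mean_inj M_gt0 base_supp reg Tt' Tt).
    by apply/eqP; rewrite eq_le -cE ub -c'E cmax.
  by rewrite /expklms_weight/= klE tE bregmanxx mulr0 oppr0 expR0.
apply: (@le_trans _ _ (expR (- ((N t a w)%:R / d * kappa)))).
  rewrite /expklms_weight/= ler_expR lerN2 ler_wpM2l// divr_ge0//.
  by rewrite ltW// (lt_trans _ d_gt1).
by rewrite ler_peMr// expR_ge0.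
Qed.

End good_round.

(** * Expected number of pulls of one suboptimal arm *)

Section arms.
Variables (a o : 'I_K) (ta to x y q : R) (u : nat).
Hypothesis Ta : Theta ta.
Hypothesis To : Theta to.
Hypothesis nua : is_member m ta (nu a).
Hypothesis nuo : is_member m to (nu o).
Hypothesis tax : ta <= x.
Hypothesis xy : x <= y.
Hypothesis yto : y <= to.
Hypothesis q_gt0 : 0 < q.
Hypothesis q_xa : q <= kl x ta.
Hypothesis q_xy : q <= kl x y.
Hypothesis q_yo : q <= kl y to.
Hypothesis u_large : d * ln T%:R <= u%:R * q.

Let Ty : Theta y.
Proof. by apply: (param_interval reg Ta To); rewrite (le_trans tax xy). Qed.

Let Tx : Theta x.
Proof. by apply: (param_interval reg Ta To); rewrite tax (le_trans xy). Qed.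

Let mpull t c : (t < T)%N -> measurable (I t.+1 @^-1` [set c]).
Proof. by move=> tT; exact: (arm_measurable run). Qed.

Let past_emp t c (A : set R) : measurable A -> past I r t.+1 (emp t c @^-1` A).
Proof.
by move=> mA; have := @past_emp_mean R K disp Omega I r t c measurableT A mA; rewrite setTI.
Qed.

Let past_N t c (A : set nat) : past I r t.+1 (N t c @^-1` A).
Proof.
by have := @past_pulls R K disp Omega I r t c measurableT A; rewrite setTI; apply.
Qed.

Let pastI t (A B : set Omega) : past I r t.+1 A -> past I r t.+1 B -> past I r t.+1 (A `&` B).
Proof.
move=> pA pB.
exact: (@measurableI _ (g_sigma_algebraType (past_generators I r t.+1)) _ _ pA pB).
Qed.

Let mY t c lambda k : (t <= T)%N ->
  measurable_fun setT (fun w => (expR (lambda * S t c w - k * (N t c w)%:R))%:E).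
Proof.
move=> tT; apply/measurable_EFinP; apply: measurableT_comp => //; apply: measurable_funB.
  apply: measurable_funM => //; apply: (past_fun_measurable run tT).
  exact: past_arm_sum.
apply: measurable_funM => //; apply: (past_fun_measurable run tT).
exact: past_pulls_natr.
Qed.

(** Round [t.+1] is decided on the data up to [t]; the events below, other than [pulled] itself,
    belong to the past of that round. *)
Let pulled t : set Omega := I t.+1 @^-1` [set a].
Let few t : set Omega := N t a @^-1` [set k | (k < u)%N].
Let over t : set Omega :=
  N t a @^-1` [set k | (0 < k)%N] `&` emp t a @^-1` [set z | mean x < z].
Let high t : set Omega := \bigcup_(c in [set: 'I_K]) emp t c @^-1` [set z | mean y <= z].
Let typical t : set Omega :=
  N t a @^-1` [set k | (u <= k)%N] `&` emp t a @^-1` [set z | z <= mean x] `&` high t.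

Let past_high t : past I r t.+1 (high t).
Proof.
apply: (@fin_bigcup_measurable _ (g_sigma_algebraType (past_generators I r t.+1))).
  exact: finite_finset.
move=> c _; apply: past_emp.
rewrite (_ : [set z | mean y <= z] = `[mean y, +oo[%classic); first exact: measurable_itv.
by apply/seteqP; split => z; rewrite /= in_itv/= andbT.
Qed.

Let past_over t : past I r t.+1 (over t).
Proof.
apply: pastI; first exact: past_N.
apply: past_emp; rewrite (_ : [set z | mean x < z] = `]mean x, +oo[%classic).
  exact: measurable_itv.
by apply/seteqP; split => z; rewrite /= in_itv/= andbT.
Qed.

Let past_typical t : past I r t.+1 (typical t).
Proof.
apply: pastI; last exact: past_high.
apply: pastI; first exact: past_N.
apply: past_emp; rewrite (_ : [set z | z <= mean x] = `]-oo, mean x]%classic).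
  exact: measurable_itv.
by apply/seteqP; split => z; rewrite /= in_itv.
Qed.

Lemma sum_prob_few : (\sum_(0 <= t < T) P (few t `&` pulled t) <= u%:R%:E)%E.
Proof.
have mA t : (t < T)%N -> measurable (few t `&` pulled t).
  move=> tT; apply: measurableI; last exact: mpull.
  by apply: (past_measurable run (ltnW tT)); exact: past_N.
pose f (t : 'I_T) w : \bar R := (\1_(few t `&` pulled t) w)%:E.
have mf t : measurable_fun setT (f t).
  by apply/measurable_EFinP; apply: measurable_indic; exact: mA.
have f0 t w : (0 <= f t w)%E by rewrite lee_fin.
have fE (t : 'I_T) : P (few t `&` pulled t) = (\int[P]_w f t w)%E.
  by have := expectation_indic P (mA t (ltn_ord t)); rewrite unlock.
rewrite big_mkord (eq_bigr _ (fun t _ => fE t)) -ge0_integral_sum//.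
have -> : u%:R%:E = (\int[P]_w (u%:R)%:E)%E.
  by have := expectation_cst P (u%:R); rewrite unlock.
apply: ge0_le_integral => //.
- by move=> w _; exact: sume_ge0.
- exact: emeasurable_sum.
- move=> w _; rewrite sumEFin lee_fin.
  have fw (t : 'I_T) : \1_(few t `&` pulled t) w = ((I t.+1 w == a) && (N t a w < u)%N)%:R :> R.
    rewrite indicE; congr (nat_of_bool _)%:R.
    apply/idP/andP => [/set_mem[]|[/eqP ? ?]]; last exact/mem_set.
    by rewrite /few /pulled/= => ? ->.
  rewrite (eq_bigr _ (fun t _ => fw t)) -natr_sum ler_nat.
  by have := count_below_le I T a u w; rewrite big_add1 big_mkord.
Qed.

Let le_integral_subset (A B : set Omega) (f g : Omega -> \bar R) :
  measurable A -> measurable B -> measurable_fun setT f -> measurable_fun setT g ->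
  (forall w, (0 <= f w)%E) -> (forall w, (0 <= g w)%E) -> A `<=` B ->
  (forall w, A w -> (f w <= g w)%E) ->
  (\int[P]_(w in A) f w <= \int[P]_(w in B) g w)%E.
Proof.
move=> mA mB mf mg f0 g0 AB fg; apply: (@le_trans _ _ (\int[P]_(w in A) g w)%E).
  by apply: ge0_le_integral => //; exact: measurable_funTS.
by apply: ge0_subset_integral => //; exact: measurable_funTS.
Qed.

Let member_mgf_shift c theta z : Theta theta -> is_member m theta (nu c) ->
  (\int[nu c]_v (expR ((z - theta) * v))%:E = (expR (b z - b theta))%:E)%E.
Proof.
move=> Tt nuc; rewrite (member_mgf base_supp (lap Tt) _ nuc).
by rewrite (_ : theta + (z - theta) = z)//; ring.
Qed.

(** Tilting arm [a] from [ta] to [x] with [delta] equal to [kl x ta] gives a process that is at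
    least 1 on [over], by [bregman_tilt]. *)
Lemma sum_prob_over : (\sum_(0 <= t < T) P (over t `&` pulled t) <= q^-1%:E)%E.
Proof.
have kl0 : 0 < kl x ta := lt_le_trans q_gt0 q_xa.
have kl_q : ((kl x ta)^-1%:E <= q^-1%:E)%E by rewrite lee_fin; exact: inv_antitone q_gt0 q_xa.
apply: le_trans kl_q.
apply: le_trans (tilted_pulls run kl0 (member_mgf_shift x Ta nua)).
rewrite big_nat [leRHS]big_nat; apply: lee_sum => t /andP[_ tT].
have mo : measurable (over t) by apply: (past_measurable run (ltnW tT)); exact: past_over.
have -> : P (over t `&` pulled t) = (\int[P]_(w in over t `&` pulled t) 1%:E)%E.
  by rewrite integral_cst ?mul1e//; by apply: measurableI => //; exact: mpull.
apply: le_integral_subset => //.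
- by apply: measurableI => //; exact: mpull.
- apply: measurableI; first exact: mpull.
  by apply: (past_measurable run (ltnW tT)); exact: past_pulls_gt0.
- by apply: mY; exact: ltnW.
- by move=> w [[? _] ?].
- move=> w [[/= N0 xw] _]; rewrite lee_fin -[leLHS]expR0 ler_expR.
  rewrite (emp_meanE r N0); apply: (bregman_tilt _ (ler0n R (N t a w))).
  by apply: mulr_ge0; rewrite subr_ge0; [exact: tax|exact: ltW xw].
Qed.

(** The empirical mean of [a] and the largest one enclose the means of [x] and [y], so the
    divergence is at least [q]; [u] is chosen to make exp(- u q / d) at most 1/T. *)
Lemma prob_typical t (N0 : set Omega) : (K <= t < T)%N ->
  measurable N0 -> P N0 = 0%E -> (forall w, ~ N0 w -> good w) ->
  (P (typical t `&` pulled t) <= (T%:R^-1)%:E)%E.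
Proof.
move=> Kt mN0 PN0 N0good; have /andP[Kt' tT] := Kt.
have TR : 0 < T%:R :> R by rewrite ltr0n.
apply: (arm_prob_le run tT _ mN0 PN0); [exact: past_typical| |]; first by rewrite invr_gt0.
move=> w [[/= uN ax] [c _ /= yc]] /N0good gw.
have [theta [theta' [Tt Tt' aE [ub _] klE]]] := good_KL Kt gw a.
have tx : theta <= x by apply: (mean_le_inv Tt Tx); rewrite -aE; exact: ax.
have yt : y <= theta' by apply: (mean_le_inv Ty Tt'); exact: le_trans yc (ub c).
have klxy : q <= kl theta theta'.
  exact: le_trans q_xy (bregman_nested b_tangent tx xy yt).
have := @good_prob_le t w Kt gw a q; rewrite klE => /(_ klxy) /le_trans; apply.
rewrite -(lnK (x := T%:R) TR) -expRN ler_expR lerN2 mulrAC ler_pdivlMr; last first.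
  exact: lt_trans ltr01 d_gt1.
rewrite mulrC; apply: (le_trans u_large); apply: ler_wpM2r; first exact: ltW q_gt0.
by rewrite ler_nat.
Qed.

Local Notation eta := (kl y to).

Let eta_gt0 : 0 < eta. Proof. exact: lt_le_trans q_gt0 q_yo. Qed.

Let level_means j : set R := [set z | exists th, [/\ Theta th, th <= y,
  mean th = z & level d eta j <= kl th y < level d eta j.+1]].

(** The set is an interval: below [y] the divergence to [y] is monotone in the parameter, and the
    mean takes all intermediate values. *)
Let level_means_measurable j : measurable (level_means j).
Proof.
apply: is_interval_measurable => z1 z2 [t1 [Tt1 t1y <- /andP[l1 l1']]].
move=> [t2 [Tt2 t2y <- /andP[l2 l2']]] z /andP[z1z zz2].
have [t12|/ltW t21] := leP t1 t2; last first.
  exists t1; split => //; last by rewrite l1.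
  apply/eqP; rewrite eq_le z1z (le_trans zz2)//.
  exact: (mu_nondecreasing b_tangent).
have z12 : mean t1 <= z <= mean t2 by rewrite z1z.
have [s /andP[t1s st2] sz] := mu_ivt b_tangent mean_lip t12 z12.
exists s; split => //.
- by apply: (param_interval reg Tt1 Tt2); rewrite t1s.
- exact: le_trans st2 t2y.
- rewrite (le_trans l2 (bregman_nested b_tangent st2 t2y (lexx y)))/=.
  exact: le_lt_trans (bregman_nested b_tangent t1s (le_trans st2 t2y) (lexx y)) l1'.
Qed.

(** A mean at this level guarantees that the divergence to [y] attains [level d eta j] exactly, at
    some [tj]. A larger mean at that level would have zero divergence from [tj], hence the same
    mean. *)
Let level_tilt j z0 : level_means j z0 -> exists tj, [/\ tj <= y,
  kl tj y = level d eta j & forall z, level_means j z -> z <= mean tj].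
Proof.
move=> [t0 [Tt0 t0y _ /andP[l0 _]]].
have lv : 0 <= level d eta j <= kl t0 y by rewrite (level_ge0 d_gt1 eta_gt0).
have [tj /andP[t0tj tjy] tjE] := bregman_ivt b_tangent mean_bounds mean_lip t0y lv.
exists tj; split => // _ [th [Tth thy <- /andP[lth _]]].
have Ttj : Theta tj.
  by apply: (param_interval reg Tt0 Ty); rewrite t0tj.
rewrite leNgt; apply/negP => tjth.
have /ltW tjth' := mean_lt_inv tjth.
have h1 : kl tj th + kl th y <= kl tj y.
  by apply: (bregman_split_le b_tangent); rewrite tjth'.
have h2 := bregman_quadratic b_tangent (L_gt0) mean_lip tj th.
have h3 : kl tj th <= 0.
  by rewrite -(lerD2r (kl th y)) add0r (le_trans h1)// tjE.
have : (mean tj - mean th) ^+ 2 <= 0.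
  by rewrite (le_trans h2)// mulr_ge0_le0// mulr_ge0// ltW// L_gt0.
by rewrite leNgt exprn_even_gt0//= subr_eq0 lt_eqF.
Qed.

Let low t j : set Omega := N t o @^-1` [set k | (0 < k)%N] `&`
  emp t o @^-1` level_means j `&` ~` high t.

Let past_low t j : past I r t.+1 (low t j).
Proof.
apply: pastI; last first.
  exact: (@measurableC _ (g_sigma_algebraType (past_generators I r t.+1)) _ (@past_high t)).
by apply: pastI; [exact: past_N|exact: past_emp].
Qed.

(** The deterministic first [K] rounds are counted apart and contribute nothing here. *)
Let U t j : \bar R := if (K <= t)%N then P (low t j `&` pulled t) else 0%E.

Let U_ge0 t j : (0 <= U t j)%E.
Proof. by rewrite /U; case: ifP. Qed.

(** Pulls of [a] are exchanged for pulls of [o] at a cost of exp(c N), with N the count of [o] and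
    [c] equal to [level j.+1 / d]. Tilting [o] from [to] to [tj] has exponent at least
    [level j + eta], by splitting at [y]; the difference is the gain. *)
Lemma sum_prob_low j : (\sum_(0 <= t < T) U t j <= (level_gain d eta j)^-1%:E)%E.
Proof.
have gain0 := level_gain_gt0 d_gt1 eta_gt0 j.
have [[z0 z0j]|noz] := pselect (exists z0, level_means j z0); last first.
  rewrite big1; first by rewrite lee_fin invr_ge0 ltW.
  move=> t _; rewrite /U; case: ifP => // _.
  rewrite (_ : low t j `&` pulled t = set0) ?measure0//.
  by apply/seteqP; split => // w [[[_ wj] _] _]; apply: noz; exists (emp t o w).
have [tj [tjy tjE tjmax]] := level_tilt z0j.
have [N0 [mN0 PN0 N0good]] := good_ae.
apply: le_trans (tilted_pulls run gain0 (member_mgf_shift tj To nuo)).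
rewrite big_nat [leRHS]big_nat; apply: lee_sum => t /andP[_ tT].
rewrite /U; case: ifP => Kt; last first.
  by apply: integral_ge0 => w _; rewrite lee_fin expR_ge0.
have KtT : (K <= t < T)%N by rewrite Kt.
pose c := level d eta j.+1 / d.
have tT' := ltnW tT.
have mlow : measurable (low t j) by apply: (past_measurable run tT'); exact: past_low.
apply: (@le_trans _ _ (\int[P]_(w in low t j `&` I t.+1 @^-1` [set o])
    (expR (c * (N t o w)%:R))%:E)%E).
  (* No empirical mean reaches [mean y] here, so the divergence of [o] to the leader is at most
     [kl th y], below [level d eta j.+1]. *)
  apply: (arm_prob_le_integral run tT _ mN0 PN0); first exact: past_low.
  move=> w [[_ [th [Tth thy thE /andP[_ lth]]]] nhigh] /N0good gw.
  have [theta [theta' [Tt Tt' oE [ub [c' c'E]] klE]]] := good_KL KtT gw o.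
  have thtE : th = theta.
    by apply: (tilted_mean_inj M_gt0 base_supp reg Tth Tt); rewrite thE.
  apply: (good_prob_compare KtT gw); rewrite klE.
  have tt' : theta <= theta' by apply: (mean_le_inv Tt Tt'); rewrite -oE; exact: ub.
  have t'y : theta' <= y.
    apply/ltW/mean_lt_inv; rewrite -c'E ltNge; apply/negP => yc'.
    by apply: nhigh; exists c'.
  have := bregman_nested b_tangent (lexx theta) tt' t'y.
  by rewrite -thtE => /le_trans; apply; exact: ltW lth.
apply: le_integral_subset.
- by apply: measurableI => //; exact: mpull.
- apply: measurableI; first exact: mpull.
  by apply: (past_measurable run tT'); exact: past_pulls_gt0.
- apply/measurable_EFinP; apply: measurableT_comp => //; apply: measurable_funM => //.
  by apply: (past_fun_measurable run tT'); exact: past_pulls_natr.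
- exact: mY.
- by move=> w; rewrite lee_fin expR_ge0.
- by move=> w; rewrite lee_fin expR_ge0.
- by move=> w [[[? _] _] ?].
- move=> w [[[/= N0o wj] _] _]; rewrite lee_fin ler_expR (emp_meanE r N0o).
  rewrite /level_gain -/c.
  apply: (@bregman_tilt_slack _ b mean tj to _ (emp t o w) c _ (ler0n R (N t o w))).
    apply: mulr_le0; rewrite subr_le0; first exact: le_trans tjy yto.
    exact: tjmax.
  rewrite -tjE; apply: (bregman_split_le b_tangent); rewrite tjy; exact: yto.
Qed.

Lemma prob_pulled t : (t < T)%N ->
  (P (pulled t) <= ((a == t :> nat)%:R)%:E + (P (few t `&` pulled t) +
     (P (over t `&` pulled t) + ((T%:R^-1)%:E + \sum_(0 <= j <oo) U t j))))%E.
Proof.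
move=> tT; have tT' := ltnW tT.
have TR : 0 <= T%:R^-1 :> R by rewrite invr_ge0.
have sU : (0 <= \sum_(0 <= j <oo) U t j)%E by apply: nneseries_ge0.
have [tK|Kt] := ltnP t K.
  rewrite /pulled first_arms//.
  by rewrite eqSS leeDl// !adde_ge0// lee_fin.
rewrite -[leLHS]add0e leeD//.
have [N0 [mN0 PN0 N0good]] := good_ae.
have KtT : (K <= t < T)%N by rewrite Kt.
have mp : measurable (pulled t) by exact: mpull.
have mcap (A : set Omega) : past I r t.+1 A -> measurable (A `&` pulled t).
  by move=> pA; apply: measurableI => //; exact: (past_measurable run tT' pA).
have mfew : measurable (few t `&` pulled t) by apply: mcap; exact: past_N.
have mover : measurable (over t `&` pulled t) by apply: mcap; exact: past_over.
have mtyp : measurable (typical t `&` pulled t) by apply: mcap; exact: past_typical.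
have mlow j : measurable (low t j `&` pulled t) by apply: mcap; exact: past_low.
pose Lw := \bigcup_j (low t j `&` pulled t).
have mLw : measurable Lw by exact: bigcup_measurable.
have PLw : (P Lw <= \sum_(0 <= j <oo) U t j)%E.
  have := measure_sigma_subadditive P mlow mLw (fun w h => h).
  by rewrite /U Kt.
(* A decision tree: small count of [a], then large empirical mean of [a], then some arm reaching
   [mean y]; what remains is sorted by the level of arm [o]. *)
have cover : pulled t `<=` ((few t `&` pulled t) `|` ((over t `&` pulled t) `|`
    ((typical t `&` pulled t) `|` Lw))) `|` N0.
  move=> w pw; have [N0w|/N0good gw] := pselect (N0 w); [by right|left].
  have Na := good_pulls KtT gw a.
  have [h|h] := ltnP (N t a w) u; [by left|right].
  have [h'|h'] := ltP (mean x) (emp t a w); [by left|right].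
  have [hi|nhi] := pselect (high t w); [by left|right].
  have [theta [theta' [Tt Tt' oE [ub [c' c'E]] klE]]] := good_KL KtT gw o.
  have t'y : theta' <= y.
    apply/ltW/mean_lt_inv; rewrite -c'E ltNge; apply/negP => yc'.
    by apply: nhi; exists c'.
  have tt' : theta <= theta' by apply: (mean_le_inv Tt Tt'); rewrite -oE; exact: ub.
  have [j lj] := level_exists d_gt1 eta_gt0 (bregman_ge0 b_tangent theta y).
  exists j => //; split => //; split => //; split; first exact: (good_pulls KtT gw o).
  by exists theta; split => //; exact: le_trans tt' t'y.
have m3 := measurableU _ _ mtyp mLw.
have m2 := measurableU _ _ mover m3.
have m1 := measurableU _ _ mfew m2.
apply: (@le_trans _ _ (P (((few t `&` pulled t) `|` ((over t `&` pulled t) `|`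
    ((typical t `&` pulled t) `|` Lw))) `|` N0))).
  by apply: le_measure; rewrite ?inE//; exact: measurableU.
rewrite measureU0//; apply: (le_trans (measureU2 _ mfew m2)); apply: leeD => //.
apply: (le_trans (measureU2 _ mover m3)); apply: leeD => //.
apply: (le_trans (measureU2 _ mtyp mLw)); apply: leeD => //.
exact: (prob_typical KtT mN0 PN0 N0good).
Qed.

(** The 2 is the initial pull plus T times 1/T for [typical]; [u] comes from [few], [1 / q] from
    [over] and [level_cst d / q] from all levels of [low]. *)
Lemma sum_prob_pulled : (\sum_(0 <= t < T) P (pulled t) <=
  (2 + u%:R + (1 + level_cst d) / q)%:E)%E.
Proof.
have q0 := ltW q_gt0.
have sumU : (\sum_(0 <= t < T) \sum_(0 <= j <oo) U t j <= (level_cst d / q)%:E)%E.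
  rewrite -nneseries_sum_nat//.
  apply: lime_le; first by apply: is_cvg_nneseries => n _ _; exact: sume_ge0.
  apply: nearW => n.
  apply: (@le_trans _ _ (\sum_(0 <= j < n) ((level_gain d eta j)^-1)%:E)%E).
    by apply: lee_sum => j _; exact: sum_prob_low.
  rewrite sumEFin lee_fin (le_trans (sum_level_gain_le d_gt1 eta_gt0 n))//.
  apply: ler_wpM2l; first exact: ltW (level_cst_gt0 d_gt1).
  exact: inv_antitone q_gt0 q_yo.
have sumT : (\sum_(0 <= t < T) (T%:R^-1)%:E <= 1%:E :> \bar R)%E.
  rewrite sumEFin lee_fin sumr_const_nat subn0 -[leLHS]mulr_natl mulfV//.
  by rewrite pnatr_eq0 -lt0n.
have suma : (\sum_(0 <= t < T) ((a == t :> nat)%:R)%:E <= 1%:E :> \bar R)%E.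
  rewrite sumEFin lee_fin -natr_sum -[leRHS]/(1%:R) ler_nat.
  have [aT|Ta'] := ltnP a T.
    rewrite (big_rem (a : nat)) ?mem_index_iota//= eqxx big1_seq ?addn0// => t.
    rewrite (rem_filter _ (iota_uniq _ _)) mem_filter => /andP[_ /andP[/= ta' _]].
    by rewrite eq_sym (negbTE ta').
  rewrite big_nat big1// => t /andP[_ tT].
  by rewrite gtn_eqF// (leq_trans tT).
apply: (@le_trans _ _ (\sum_(0 <= t < T) (((a == t :> nat)%:R)%:E +
  (P (few t `&` pulled t) + (P (over t `&` pulled t) +
   ((T%:R^-1)%:E + \sum_(0 <= j <oo) U t j)))))%E).
  by rewrite big_nat [leRHS]big_nat; apply: lee_sum => t /andP[_ tT]; exact: prob_pulled.
rewrite !big_split/=.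
have -> : 2 + u%:R + (1 + level_cst d) / q =
  1 + (u%:R + (q^-1 + (1 + level_cst d / q))) by ring.
rewrite !EFinD; apply: leeD suma _; apply: leeD sum_prob_few _.
by apply: leeD sum_prob_over _; exact: leeD sumT sumU.
Qed.

End arms.

(** * From pull counts to regret *)

Lemma expectation_arms (g : 'I_K -> R) : (forall a, 0 <= g a) ->
  ('E_P[fun w => (\sum_(1 <= t < T.+1) g (I t w))%R] =
  \sum_(a < K) (g a)%:E * \sum_(0 <= t < T) P (I t.+1 @^-1` [set a]))%E.
Proof.
move=> g0; rewrite unlock.
pose f (t : 'I_T) (a : 'I_K) w : \bar R := ((g a)%:E * (\1_(I t.+1 @^-1` [set a]) w)%:E)%E.
have mIt (t : 'I_T) a : measurable (I t.+1 @^-1` [set a]).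
  by apply: (arm_measurable run); rewrite /= ltn_ord.
have mind (t : 'I_T) a : measurable_fun setT (fun w => (\1_(I t.+1 @^-1` [set a]) w : R)%:E).
  by apply/measurable_EFinP; exact: measurable_indic.
have mf t a : measurable_fun setT (f t a).
  by apply: emeasurable_funM => //; exact: mind.
have f0 t a w : (0 <= f t a w)%E by rewrite mule_ge0 ?lee_fin.
have fE t a : (\int[P]_w f t a w = (g a)%:E * P (I t.+1 @^-1` [set a]))%E.
  rewrite ge0_integralZl_EFin//; congr (_ * _)%E.
  by have := expectation_indic P (mIt t a); rewrite unlock.
transitivity (\int[P]_w (\sum_(t < T) \sum_(a < K) f t a w))%E.
  apply: eq_integral => w _; rewrite big_add1 big_mkord -sumEFin.
  apply: eq_bigr => t _; rewrite (bigD1 (I t.+1 w))//= big1 ?adde0 => [|a /negbTE aI].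
    by rewrite /f indicE mem_set// mule1.
  rewrite /f indicE memNset ?mule0// => /= /esym/eqP.
  by rewrite aI.
rewrite ge0_integral_sum//; last 2 first.
- by move=> t; exact: emeasurable_sum.
- by move=> t w _; exact: sume_ge0.
transitivity (\sum_(t < T) \sum_(a < K) (g a)%:E * P (I t.+1 @^-1` [set a]))%E.
  by apply: eq_bigr => t _; rewrite ge0_integral_sum//; apply: eq_bigr => a _; exact: fE.
rewrite exchange_big/=; apply: eq_bigr => a _.
by rewrite big_mkord ge0_sume_distrr.
Qed.

Lemma gap_ge0 a : 0 <= gap nu a.
Proof.
rewrite /gap; have [c -> cmax] := max_overP (fun b => law_mean (nu b)) K_gt0.
by rewrite subr_ge0.
Qed.

Lemma sum_prob_arm a : 0 < gap nu a -> (\sum_(0 <= t < T) P (I t.+1 @^-1` [set a]) <=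
  (3 + (d * ln T%:R + 1 + level_cst d) / (gap nu a ^+ 2 / (72 * M ^+ 2)))%:E)%E.
Proof.
move=> gap0; have [c maxE _] := max_overP (fun b => law_mean (nu b)) K_gt0.
have [ta Ta nua] := nuF a; have [to To nuo] := nuF c.
have meana := member_mean M_gt0 base_supp (lap Ta) nua.
have meano := member_mean M_gt0 base_supp (lap To) nuo.
have gapE : gap nu a = mean to - mean ta by rewrite /gap maxE meana meano.
move: gap0; rewrite gapE; set D3 := (mean to - mean ta) => D3_gt0.
have mean_to : mean to = mean ta + D3 by rewrite /D3 addrC subrK.
have taato : ta <= to by apply/ltW/mean_lt_inv; rewrite mean_to ltrDl.
have [|x /andP[tax xto] xE] := mu_ivt b_tangent mean_lip (v := mean ta + D3 / 3) taato.
  by rewrite mean_to; exact: third_le.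
have [|y /andP[xy yto] yE] := mu_ivt b_tangent mean_lip (v := mean to - D3 / 3) xto.
  by rewrite xE mean_to; exact: two_thirds_le.
have M2 : 0 < M ^+ 2 by rewrite exprn_gt0.
(* This is [(D3 / 3) ^+ 2 / (4 * (2 * M ^+ 2))]: a third of the gap in [bregman_quadratic], with
   Lipschitz constant [2 * M ^+ 2]. *)
pose q := D3 ^+ 2 / (72 * M ^+ 2).
have q_gt0 : 0 < q by rewrite divr_gt0 ?exprn_gt0 ?mulr_gt0.
have q_kl z z' : mean z - mean z' = D3 / 3 \/ mean z' - mean z = D3 / 3 -> q <= kl z z'.
  move=> h; have := bregman_quadratic b_tangent L_gt0 mean_lip z z'.
  have -> : (mean z - mean z') ^+ 2 = (D3 / 3) ^+ 2.
    by case: h => <- //; rewrite -sqrrN opprB.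
  by rewrite /q ler_pdivrMr ?mulr_gt0//; exact: third_sqr_le.
have q_xa : q <= kl x ta by apply: q_kl; left; rewrite xE addrC addKr.
have q_yo : q <= kl y to by apply: q_kl; right; rewrite yE opprB addrC subrK.
have q_xy : q <= kl x y.
  apply: q_kl; right; rewrite yE xE mean_to; exact: third_diff.
have lnT : 0 <= ln T%:R :> R by rewrite ln_ge0// ler1n.
have dlnT : 0 <= d * ln T%:R / q.
  by rewrite divr_ge0 ?(ltW q_gt0)// mulr_ge0// ltW// (lt_trans _ d_gt1).
(* Rounding up costs at most 1, which turns the 2 of [sum_prob_pulled] into 3. *)
pose u := (Num.truncn (d * ln T%:R / q)).+1.
have /andP[u1 u2] := truncn_itv dlnT.
have u_large : d * ln T%:R <= u%:R * q.
  by rewrite -ler_pdivrMr//; exact: ltW u2.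
apply: (le_trans (sum_prob_pulled Ta To nua nuo tax xy yto q_gt0 q_xa q_xy q_yo u_large)).
rewrite lee_fin -/q /u -natr1.
have -> : (d * ln T%:R + 1 + level_cst d) / q =
  d * ln T%:R / q + (1 + level_cst d) / q by rewrite -mulrDl addrA.
rewrite [leLHS](_ : _ = 3 + ((Num.truncn (d * ln T%:R / q))%:R + (1 + level_cst d) / q)).
  by rewrite lerD2l lerD2r.
ring.
Qed.

End bandit.

(** Lets constants be absorbed into multiples of ln T. *)
Lemma ln_nat_ge_half {R : realType} (T : nat) : (2 <= T)%N -> 1 / 2 <= ln T%:R :> R.
Proof.
move=> T2; rewrite -ler_expR lnK ?posrE ?ltr0n ?(leq_trans _ T2)//.
have : expR (1 / 2) <= 1 + 2 * (1 / 2) :> R by apply: expR_double_ge; lra.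
have : 2 <= T%:R :> R by rewrite ler_nat.
lra.
Qed.

(** Since [2 * l >= 1], the constant [1 + k] is at most [2 * (1 + k) * l]; the other terms on the
    right are nonnegative. *)
Lemma regret_term_le {R : realType} (D l m2 d k : R) :
  0 < D -> 0 < m2 -> 0 <= d -> 0 <= k -> 1 / 2 <= l ->
  D * (3 + (d * l + 1 + k) / (D ^+ 2 / (72 * m2))) <=
  (3 + 72 * m2 * (d + 2 * (1 + k))) * (l / D + D).
Proof.
move=> D0 m20 d0 k0 l0.
have -> : D * (3 + (d * l + 1 + k) / (D ^+ 2 / (72 * m2))) =
  3 * D + 72 * m2 * (d * l + 1 + k) / D by field; rewrite !gt_eqF.
have -> : (3 + 72 * m2 * (d + 2 * (1 + k))) * (l / D + D) = 3 * D +
  72 * m2 * ((d + 2 * (1 + k)) * l) / D +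
  (3 * (l / D) + 72 * m2 * (d + 2 * (1 + k)) * D) by ring.
have dk : d * l + 1 + k <= (d + 2 * (1 + k)) * l.
  have : 0 <= (1 + k) * (2 * l - 1) by apply: mulr_ge0; lra.
  lra.
have rest : 0 <= 3 * (l / D) + 72 * m2 * (d + 2 * (1 + k)) * D.
  have l1 : 0 <= l by lra.
  have h1 : 0 <= l / D by apply: divr_ge0; lra.
  have h2 : 0 <= 72 * m2 * (d + 2 * (1 + k)) * D.
    by apply: mulr_ge0; [apply: mulr_ge0|]; lra.
  lra.
rewrite -[leLHS]addr0 lerD// lerD2l ler_wpM2r ?invr_ge0 ?(ltW D0)//.
by rewrite ler_wpM2l// mulr_ge0// ltW.
Qed.

Theorem corollary11 (R : realType) (d M CL : R) (V : R -> R) :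
  1 < d -> 0 < M -> 0 < CL ->
  (forall mu mu' : R, 0 < mu <= M -> 0 < mu' <= M ->
    `|V mu - V mu'| <= CL * `|mu - mu'|) ->
  exists C : R, 0 < C /\
    forall (m : {measure set (measurableTypeR R) -> \bar R}) (Theta : set R),
      is_regular_expfam m Theta ->
      (forall nu, expfam m Theta nu -> 0 < law_mean nu <= M) ->
      is_variance_function (expfam m Theta) V ->
    forall (K T : nat) (nu : 'I_K -> probability (measurableTypeR R) R),
      (2 <= K)%N -> (2 <= T)%N ->
      (forall a, expfam m Theta (nu a)) ->
    forall (disp : measure_display) (Omega : measurableType disp)
      (P : probability Omega R)
      (I : nat -> Omega -> 'I_K) (r : nat -> Omega -> R),
      is_expklms_run (expfam m Theta) (fun k => k%:R / d) nu T P I r ->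
      emp_means_in_family (expfam m Theta) T P I r ->
      (regret nu T P I <=
         (C * \sum_(a < K | 0 < gap nu a)
                (ln T%:R / gap nu a + gap nu a))%:E)%E.
Proof.
move=> d_gt1 M_gt0 _ _.
have c_gt0 := level_cst_gt0 d_gt1; have M2 : 0 < M ^+ 2 by rewrite exprn_gt0.
exists (3 + 72 * M ^+ 2 * (d + 2 * (1 + level_cst d))); split.
  by rewrite addr_gt0// !mulr_gt0//; lra.
move=> m Theta reg means _ K T nu K2 T2 nuF disp Omega P I r run empF.
have K_gt0 := ltnW K2; have T_gt0 := ltnW T2.
have gap0 := gap_ge0 K_gt0 (nu := nu).
rewrite /regret (expectation_arms run gap0).
rewrite (bigID (fun a => 0 < gap nu a))/= [X in (_ + X)%E]big1 ?adde0; last first.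
  move=> a; rewrite -leNgt => gapa; have -> : gap nu a = 0.
    by apply/eqP; rewrite eq_le gapa gap0.
  by rewrite mul0e.
rewrite mulr_sumr -sumEFin; apply: lee_sum => a gapa.
have := sum_prob_arm M_gt0 d_gt1 reg means K_gt0 T_gt0 nuF run empF gapa.
move=> h; apply: (le_trans (lee_wpmul2l _ h)); first by rewrite lee_fin ltW.
rewrite -EFinM lee_fin.
exact: regret_term_le gapa M2 (ltW (lt_trans ltr01 d_gt1)) (ltW c_gt0) (ln_nat_ge_half T2).
Qed.
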